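(* Let $a,b,c\in\mathbb{N}$ and let $2<s<t$ be real numbers. Then \[ \dim_{\mathrm{H}}\bigl(\{\alpha\in[s,t]\colon ax+by=cz \text{ is solvable in } \mathrm{PS}(\alpha)\}\bigr)\ \ge\ \begin{cases} \left(s+\dfrac{s^3}{(2+\{s\}-2^{1-\lfloor s\rfloor})(2-\{s\})}\right)^{-1} & \text{if } a=b=c,\\[12pt] 2\left(s+\dfrac{s^3}{(2+\{s\}-2^{1-\lfloor s\rfloor})(2-\{s\})}\right)^{-1} & \text{otherwise.} \end{cases} \]
   Context: For real $x$, $\lfloor x\rfloor$ is the integer part and $\{x\}=x-\lfloor x\rfloor$ the fractional part. For a non-integral real $\alpha>0$, $\mathrm{PS}(\alpha)=\{\lfloor n^\alpha\rfloor\colon n\in\mathbb{N}\}$, where $\mathbb{N}=\{1,2,\dots\}$; for integral $\alpha$ the same formula is used. A tuple $(x_1,\dots,x_k)$ is called pairwise distinct if $\#\{x_1,\dots,x_k\}=k$. The equation $ax+by=cz$ is said to be solvable in $\mathrm{PS}(\alpha)$ if there are infinitely many tuples $(x,y,z)\in\mathrm{PS}(\alpha)^3$, each pairwise distinct, satisfying $ax+by=cz$. $\dim_{\mathrm{H}}$ denotes Hausdorff dimension of a subset of $\mathbb{R}$. *)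

(* Defs.v *)
From mathcomp Require Import all_boot all_order all_algebra.
From mathcomp Require Import all_classical all_reals all_analysis.

Set Implicit Arguments.
Unset Strict Implicit.
Unset Printing Implicit Defensive.

Import Order.TTheory GRing.Theory Num.Theory.

Local Open Scope classical_set_scope.
Local Open Scope ring_scope.

Section HausdorffDimension.
Context {R : realType}.
Local Open Scope ereal_scope.

(* The maximum with 0 only matters for U = set0, where the supremum is -oo. *)
Definition diam (U : set R) : \bar R :=
  maxe 0 (ereal_sup [set (`|p.1 - p.2|%R)%:E | p in U `*` U]).

(* diam U to the power d, with 0 ^ 0 = 1 for singletons and the value 0 for
   U = set0, also when d = 0, so that finite covers are padded by set0 for
   free. *)
Definition gauge (d : R) (U : set R) : \bar R :=
  if U == set0 then 0 else diam U `^ d.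

Definition hausdorff_premeasure (d delta : R) (A : set R) : \bar R :=
  ereal_inf [set \sum_(0 <= k <oo) gauge d (U k) | U in
    [set U : (set R)^nat | A `<=` \bigcup_k U k /\
                           forall k, diam (U k) <= delta%:E]].

(* The premeasure is nonincreasing in delta, so this supremum is its limit as
   delta tends to 0 from the right. *)
Definition hausdorff_measure (d : R) (A : set R) : \bar R :=
  ereal_sup [set hausdorff_premeasure d delta A | delta in
    [set delta : R | (0 < delta)%R]].

Definition hausdorff_dim (A : set R) : \bar R :=
  ereal_inf [set d%:E | d in
    [set d : R | (0 <= d)%R /\ hausdorff_measure d A = 0]].

End HausdorffDimension.

Section PiatetskiShapiro.
Context {R : realType}.

Definition frac_part (x : R) : R := x - (Num.floor x)%:~R.

Definition PS (alpha : R) : set int :=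
  [set Num.floor (n%:R `^ alpha) | n in [set n : nat | (0 < n)%N]].

Definition solvable_in_PS (a b c : nat) (alpha : R) : Prop :=
  infinite_set [set p : int * int * int | let: (x, y, z) := p in
    [/\ PS alpha x, PS alpha y & PS alpha z] /\
    uniq [:: x; y; z] /\
    a%:Z * x + b%:Z * y = c%:Z * z].

End PiatetskiShapiro.

(* Main.v *)
Require Import Defs.
From mathcomp Require Import all_boot all_order all_algebra.
From mathcomp Require Import all_classical all_reals all_analysis.
From mathcomp Require Import ring lra zify.

Import Order.TTheory GRing.Theory Num.Theory.
Import numFieldNormedType.Exports.

Local Open Scope classical_set_scope.
Local Open Scope ring_scope.

(** The dimension is in fact at least 1/s, which dominates both bounds because
    s^3 / ((2 + {s} - 2^(1 - [s])) (2 - {s})) >= s.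

    Fix a large integer Q. For a large integer k, let n range over the integers
    for which c n^al0 = b (Qk)^al0 + a k^al0 has a root al0 in a given interval;
    since al0 depends only on n/k, these roots are about 1/k apart. When al
    moves by O(k^(-al0) / ln k) away from the root, the three powers move by
    amounts of order 1 while c n^al - b (Qk)^al - a k^al stays O(1 / ln k),
    as it grows slower by a factor ln k. Because (Qk)^al moves Q^al times faster
    than k^al, there is a moment when k^al and (Qk)^al both lie just above
    multiples c X and c Z of c. Then the integer parts of k^al, (Qk)^al and n^al
    are c X, c Z and b Z + a X, which solve the equation, and they stay so on an
    interval of length k^(-v2), for any v2 exceeding the exponents in play.

    So every interval contains about k intervals of good exponents of length
    k^(-v2), at distance about 1/k from each other. If d v2 < 1, a cover of small
    d-dimensional weight cannot contain all points lying in such intervals for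
    infinitely many k: averaging over the subintervals produces nested ones
    whose share of the cover keeps getting lighter, and their common point is
    covered by no member. *)

(** * The curve c nu^al = b Q^al + a *)

Section PowerEstimates.
Context {R : realType}.
Implicit Types x y p h k : R.

Lemma powRE x h : 0 < x -> x `^ h = expR (h * ln x).
Proof. by move=> x0; rewrite -{1}(lnK (x := x)) ?posrE// -expRM mulrC. Qed.

Lemma gt0_powRD x h k : 0 < x -> x `^ (h + k) = x `^ h * x `^ k.
Proof. by move=> x0; rewrite powRD// (gt_eqF x0) implybT. Qed.

Lemma ge1_powR x h : 1 <= x -> 0 <= h -> 1 <= x `^ h.
Proof. by move=> x1 h0; rewrite -(powRr0 x) ler_powR. Qed.

Lemma powR_sub1_ge x h : 0 < x -> h * ln x <= x `^ h - 1.
Proof. by move=> x0; rewrite powRE// lerBrDl expR_ge1Dx. Qed.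

Lemma powR_sub1_le x h : 0 < x -> x `^ h - 1 <= h * ln x * x `^ h.
Proof.
move=> x0; have := powR_sub1_ge x (- h) x0; rewrite powRN.
have xh := powR_gt0 h x0.
rewrite -(ler_pM2r xh) mulrBl mulVf ?gt_eqF// mul1r; lra.
Qed.

Lemma ler_powR_inv x y p : 0 < p -> 0 <= x -> 0 <= y ->
  x `^ p <= y `^ p -> x <= y.
Proof.
move=> p0 x0 y0; rewrite leNgt => h; rewrite leNgt; apply/negP => yx.
by move/negP: h; apply; apply: gt0_ltr_powR.
Qed.

Lemma powR_sub_ge x y p : 1 <= y -> y <= x -> 1 <= p ->
  x - y <= x `^ p - y `^ p.
Proof.
move=> y1 yx p1; have y0 : 0 < y by lra.
pose z := x / y; have -> : x = y * z by rewrite mulrC divfK// gt_eqF.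
have z1 : 1 <= z by rewrite /z ler_pdivlMr// mul1r.
rewrite powRM; [|lra|lra].
have h1 := le1r_powR z1 p1; have h2 := le1r_powR y1 p1.
nra.
Qed.

Lemma powR_sub_le x y p : 1 <= y -> y <= x -> 0 <= p ->
  x `^ p - y `^ p <= p * x `^ p * (x - y).
Proof.
move=> y1 yx p0; have y0 : 0 < y by lra.
pose z := x / y; have -> : x = y * z by rewrite mulrC divfK// gt_eqF.
have z1 : 1 <= z by rewrite /z ler_pdivlMr// mul1r.
have z0 : 0 < z by lra.
rewrite powRM; [|lra|lra].
have h1 := powR_sub1_le z p z0; have h2 := ge1_powR y p y1 p0.
have h3 := ge1_powR z p z1 p0.
have h4 : ln z <= z - 1 by have := @le_ln1Dx R (z - 1); rewrite (addrC 1) subrK; apply; lra.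
have h5 : y * z - y >= z - 1 by nra.
have h6 : y `^ p * (z `^ p - 1) <= y `^ p * (p * (y * z - y) * z `^ p).
  rewrite ler_pM2l ?powR_gt0//; apply: le_trans h1 _.
  rewrite ler_pM2r ?powR_gt0// ler_wpM2l//; lra.
by lra.
Qed.

End PowerEstimates.

Section Curve.
Context {R : realType}.
Implicit Types a b c Q v al h nu : R.

(** The equation at [al] trades c nu^al for b Q^al + a, which shows that the defect vanishes with
    [h]. *)
Lemma curve_shift a b c Q nu al h : 0 < Q -> 0 < nu -> c * nu `^ al = b * Q `^ al + a ->
  c * nu `^ (al + h) - b * Q `^ (al + h) - a =
  b * Q `^ al * (nu `^ h - Q `^ h) + a * (nu `^ h - 1).
Proof.
move=> Q0 nu0 e.
rewrite !gt0_powRD //.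
rewrite (mulrA c) e; ring.
Qed.

(** Lets the constants below depend on a, b, Q and the largest exponent, but not on the point of the
    curve. *)
Lemma curve_le a b c Q nu al : 1 <= a -> 1 <= b -> 1 <= c -> 1 <= Q ->
  0 < nu -> 1 <= al -> c * nu `^ al = b * Q `^ al + a ->
  nu <= (a + b) * Q.
Proof.
move=> a1 b1 c1 Q1 nu0 al1 e; apply: (@ler_powR_inv _ _ _ al); [lra|lra|nra|].
rewrite powRM; [|lra|lra].
have h1 : 1 <= Q `^ al by apply: ge1_powR; lra.
have h2 : a + b <= (a + b) `^ al by apply: le1r_powR; lra.
have h3 := powR_gt0 al nu0.
have h4 : nu `^ al <= c * nu `^ al by rewrite ler_peMl// ltW.
have : b * Q `^ al + a <= (a + b) * Q `^ al by nra.
have : (a + b) * Q `^ al <= (a + b) `^ al * Q `^ al by rewrite ler_pM2r//; lra.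
by lra.
Qed.

(** A Lipschitz constant for the defect in the shift [h]: both nu and Q are at most B, so B^v ln B
    bounds the slope of their powers, and (a + b) B^v bounds b Q^al + a. *)
Definition curve_lip a b Q v := let B := (a + b) * Q in
  (a + b) * B `^ v * (ln B * B `^ v).

Lemma curve_upper a b c Q v nu al h :
  1 <= a -> 1 <= b -> 1 <= c -> 1 <= Q ->  1 <= nu -> 1 <= al <= v -> 0 <= h <= v ->
  c * nu `^ al = b * Q `^ al + a ->
  `|c * nu `^ (al + h) - b * Q `^ (al + h) - a| <= curve_lip a b Q v * h.
Proof.
move=> a1 b1 c1 Q1 nu1 /andP[al0 alv] /andP[h0 hv] e.
have : nu <= (a + b) * Q by apply: curve_le e; lra.
have : Q <= (a + b) * Q by nra.
rewrite /curve_lip; set B := (a + b) * Q => QB nuB.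
have B1 : 1 <= B by exact: le_trans QB.
rewrite (@curve_shift _ _ c)//; try lra.
have H x : 1 <= x -> x <= B -> 1 <= x `^ h <= 1 + ln B * B `^ v * h.
  move=> x1 xB; rewrite ge1_powR//=.
  have : x `^ h <= B `^ h by apply: ge0_ler_powR => //; rewrite ?nnegrE; lra.
  have := powR_sub1_le B h ltac:(lra).
  have : h * ln B * B `^ h <= h * ln B * B `^ v.
    by rewrite ler_wpM2l ?ler_powR// mulr_ge0// ln_ge0.
  lra.
have /andP[n1 n2] := H _ nu1 nuB.
have /andP[q1 q2] := H _ Q1 QB.
have q3 : Q `^ al <= B `^ v.
  apply: (@le_trans _ _ (Q `^ v)); first by rewrite ler_powR.
  by apply: ge0_ler_powR => //; rewrite ?nnegrE; lra.
have q4 : 1 <= Q `^ al by apply: ge1_powR; lra.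
set t := ln B * B `^ v * h in n2 q2.
apply: (@le_trans _ _ (b * Q `^ al * t + a * t)).
  apply: le_trans (ler_normD _ _) _; rewrite !normrM; apply: lerD.
    rewrite (ger0_norm (x := b)) ?(ger0_norm (x := Q `^ al)); [|lra|lra].
    by rewrite ler_wpM2l ?mulr_ge0 ?powR_ge0 ?ler_norml//; lra.
  rewrite (ger0_norm (x := a)); last lra.
  by rewrite ler_wpM2l ?ler_norml//; lra.
have -> : (a + b) * B `^ v * (ln B * B `^ v) * h = (a + b) * B `^ v * t.
  by rewrite /t; ring.
have t0 : 0 <= t by lra.
rewrite -mulrDl ler_wpM2r//; nra.
Qed.

(* Along the curve the defect is monotone in the exponent, increasing if c <= b
   and, for large Q, decreasing if b < c. *)
Lemma curve_lower a b c Q v nu al h :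
  1 <= a -> 1 <= b -> 1 <= c ->  1 <= nu -> 2 <= al <= v -> 0 <= h ->
  3 <= Q -> 2 * a <= Q -> 2 * c * v * (a + 1) <= Q -> c <= b \/ b + 1 <= c ->
  c * nu `^ al = b * Q `^ al + a ->
  h / 2 <= `|c * nu `^ (al + h) - b * Q `^ (al + h) - a|.
Proof.
move=> a1 b1 c1 nu1 /andP[al2 alv] h0 Q3 Qa Qv bc e.
have nu0 : 0 < nu by lra.
have Q0 : 0 < Q by lra.
have lnQ1 : 1 <= 2 * ln Q.
  have := powR_sub1_ge Q (- 1) Q0; rewrite (powR_inv1 (ltW Q0)).
  have : Q^-1 <= 3^-1 by rewrite lef_pV2// posrE; lra.
  lra.
rewrite (@curve_shift _ _ c)//.
set q := Q `^ al in e *.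
have qQ : Q * Q <= q.
  have -> : Q * Q = Q `^ 2%:R by rewrite powR_mulrn ?expr2//; lra.
  by rewrite ler_powR//; lra.
(* If c <= b, then nu >= Q, both terms of the shifted defect are nonnegative, and the second alone
   gives h ln Q >= h / 2. *)
case: bc => bc.
  have Qnu : Q <= nu.
    apply: (@ler_powR_inv _ _ _ al); [lra|lra|lra|].
    rewrite -/q; have := powR_gt0 al nu0; nra.
  have h1 : Q `^ h <= nu `^ h by apply: ge0_ler_powR => //; rewrite nnegrE; lra.
  have h2 := powR_sub1_ge Q h Q0.
  have h3 : h <= h * (2 * ln Q) by rewrite ler_peMr.
  apply: le_trans (ler_norm _).
  have : 0 <= b * q * (nu `^ h - Q `^ h) by rewrite !mulr_ge0 ?powR_ge0//; lra.
  have : nu `^ h - 1 <= a * (nu `^ h - 1) by rewrite ler_peMl//; lra.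
  lra.
have nuQ : nu <= Q.
  apply: (@ler_powR_inv _ _ _ al); [lra|lra|lra|].
  rewrite -/q; have := powR_gt0 al nu0; nra.
pose z := Q / nu.
have z0 : 0 < z by rewrite divr_gt0.
have Qz : Q = nu * z by rewrite mulrC divfK// gt_eqF.
have h1 := powR_sub1_ge z h z0.
have h2 := powR_sub1_le nu h nu0.
have h3 : Q `^ h = nu `^ h * z `^ h by rewrite Qz powRM//; lra.
have nh1 := ge1_powR nu h nu1 h0.
(* On the curve (nu / Q)^al = (b + a / q) / c. Since c - b >= 1 and a / q <= 1/2, this is at most 1
   - 1 / (2 c), which keeps ln z away from 0. *)
have h4 : 1 <= 2 * c * (al * ln z).
  have := powR_sub1_ge z (- al) z0; rewrite powRN.
  have za0 := powR_gt0 al z0.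
  have qz : q = nu `^ al * z `^ al by rewrite -powRM -?Qz//; lra.
  have q0 : 0 < q by nra.
  have : c * q * (z `^ al)^-1 = b * q + a by rewrite {1}qz mulrA mulfK ?gt_eqF.
  set w := (z `^ al)^-1 => wq hw.
  rewrite -(ler_pM2l q0) mulr1.
  have : 0 <= c * q * (al * ln z - (1 - w)) by rewrite !mulr_ge0//; lra.
  nra.
(* Minus the derivative of the defect at h = 0: the first term is at least of order Q^2 and beats a
   ln nu <= a Q. *)
have h5 : 1 <= b * q * ln z - a * ln nu.
  have lz0 : 0 <= ln z.
    by rewrite ln_ge0// ler_pdivlMr// mul1r.
  have l1 : ln nu <= Q.
    by apply: le_trans (_ : ln Q <= Q); [rewrite ler_ln|exact/ltW/ln_sublinear].
  have l2 : 1 <= 2 * c * v * ln z.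
    apply: le_trans h4 _; have : al * ln z <= v * ln z by rewrite ler_wpM2r.
    nra.
  have l3 : Q * Q * ln z <= b * q * ln z.
    rewrite ler_wpM2r//; nra.
  have l4 : Q * (2 * c * v * (a + 1)) * ln z <= Q * Q * ln z.
    by rewrite ler_wpM2r// ler_wpM2l// ltW.
  have l5 : Q * (a + 1) <= Q * (2 * c * v * (a + 1)) * ln z.
    have -> : Q * (2 * c * v * (a + 1)) * ln z = Q * (a + 1) * (2 * c * v * ln z).
      by ring.
    by rewrite ler_peMr// mulr_ge0//; lra.
  have : a * ln nu <= a * Q by rewrite ler_wpM2l//; lra.
  lra.
rewrite ler_normr; apply/orP; right.
rewrite h3; set n := nu `^ h in h2 nh1 *; set y := z `^ h in h1 *.
have b0 : 0 <= b * q * n by rewrite !mulr_ge0 ?powR_ge0//; lra.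
have k1 : b * q * n * (h * ln z) <= b * q * n * (y - 1) by rewrite ler_wpM2l.
have k2 : a * (n - 1) <= a * (h * ln nu * n) by rewrite ler_wpM2l//; lra.
have k3 : h * n * 1 <= h * n * (b * q * ln z - a * ln nu).
  by rewrite ler_wpM2l// mulr_ge0//; lra.
have k4 : h <= h * n by rewrite ler_peMr.
lra.
Qed.

End Curve.

(** * Solutions near a point of the curve *)

Section Window.
Context {R : realType}.
Implicit Types x y w p q eta v al : R.

Lemma ler_powR_exp x p q : 1 < x -> (x `^ p <= x `^ q) = (p <= q).
Proof.
by move=> x1; rewrite !powRE ?(lt_trans ltr01)// ler_expR ler_pM2r ?ln_gt0.
Qed.

Lemma powR_log x w : 1 < x -> 0 < w -> x `^ (ln w / ln x) = w.
Proof.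
move=> x1 w0; rewrite powRE ?(lt_trans ltr01)// divfK ?lnK//.
by rewrite gt_eqF// ln_gt0.
Qed.

Lemma ceilM_itv (c : nat) x : (0 < c)%N ->
  x <= c%:R * (Num.ceil (x / c%:R))%:~R < x + c%:R.
Proof.
move=> c0; have c0' : 0 < c%:R :> R by rewrite ltr0n.
have /andP[] := ceil_itv (x / c%:R); rewrite ltr_pdivlMr// ler_pdivrMr//.
rewrite intrD; lra.
Qed.

(** As y exceeds (a + c) x, it differs from x; x = z would give c x >= y, and y = z would give (c -
    b) y = a x, where the left side is either at most 0 or at least y. *)
Lemma uniq_of_dominated (a b c : nat) (x y z : int) :
  (0 < a)%N -> (0 < b)%N -> (0 < c)%N -> 1 <= x ->
  (a%:Z + c%:Z) * x < y -> a%:Z * x + b%:Z * y = c%:Z * z ->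
  uniq [:: x; y; z].
Proof.
move=> a0 b0 c0 x1 xy e; rewrite /= !inE !negb_or andbT -andbA.
have x0 : 0 <= x by lia.
have ax : x <= a%:Z * x by rewrite -[leLHS]mul1r ler_wpM2r//; lia.
have cx : x <= c%:Z * x by rewrite -[leLHS]mul1r ler_wpM2r//; lia.
have y0 : 0 <= y by lia.
have by1 : y <= b%:Z * y by rewrite -[leLHS]mul1r ler_wpM2r//; lia.
apply/and3P; split=> //; apply/eqP.
- move=> exy; lia.
- move=> exz; subst z; lia.
- move=> eyz; subst z.
  have [bc|bc] : c%:Z <= b%:Z \/ b%:Z + 1 <= c%:Z by lia.
    have := ler_wpM2r y0 bc; lia.
  have := ler_wpM2r y0 bc; lia.
Qed.

(** The bound k <= x turns solutions at arbitrarily large k into infinitely many triples. *)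
Definition solution_above (a b c k : nat) al := exists x y z : int,
  [/\ PS al x, PS al y & PS al z] /\ uniq [:: x; y; z] /\
  a%:Z * x + b%:Z * y = c%:Z * z /\ k%:Z <= x.

(** The floors are c X, c Z and b Z + a X, and a (c X) + b (c Z) = c (b Z + a X). The lower margins
    absorb a negative defect; the upper margins and the defect together keep c n^al less than 1
    above c (b Z + a X). *)
Lemma floors_solve (a b c k m n : nat) (X Z : int) al eta :
  (0 < a)%N -> (0 < b)%N -> (0 < c)%N -> (0 < k)%N -> (0 < m)%N -> (0 < n)%N ->
  1 <= al ->
  0 < eta -> eta * (2 * b%:R + 3 * a%:R + 1) < 1 ->
  c%:R * X%:~R + eta <= k%:R `^ al <= c%:R * X%:~R + 3 * eta ->
  c%:R * Z%:~R + eta <= m%:R `^ al <= c%:R * Z%:~R + 2 * eta ->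
  (a%:R + c%:R + 1) * k%:R `^ al <= m%:R `^ al ->
  `|c%:R * n%:R `^ al - b%:R * m%:R `^ al - a%:R * k%:R `^ al| <= eta ->
  solution_above a b c k al.
Proof.
move=> a0 b0 c0 k0 m0 n0 al1 eta0 etas kX mZ mk F.
have a1 : 1 <= a%:R :> R by rewrite ler1n.
have b1 : 1 <= b%:R :> R by rewrite ler1n.
have c1 : 1 <= c%:R :> R by rewrite ler1n.
have k1 : 1 <= k%:R :> R by rewrite ler1n.
have kal : k%:R <= k%:R `^ al :> R by exact: le1r_powR.
have ae : eta <= a%:R * eta by rewrite ler_peMl// ltW.
have be : eta <= b%:R * eta by rewrite ler_peMl// ltW.
have eta3 : 3 * eta < 1 by lra.
have fk : Num.floor (k%:R `^ al) = c%:Z * X.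
  by apply: floor_def; rewrite intrD intrM; move: kX; lra.
have fm : Num.floor (m%:R `^ al) = c%:Z * Z.
  by apply: floor_def; rewrite intrD intrM; move: mZ; lra.
have fn : Num.floor (n%:R `^ al) = b%:Z * Z + a%:Z * X.
  apply: floor_def; rewrite !intrD !intrM; move: kX mZ F.
  rewrite -!pmulrn ler_norml => /andP[X1 X2] /andP[Z1 Z2] /andP[F1 F2].
  set w := k%:R `^ al in X1 X2 F1 F2 *; set y := m%:R `^ al in Z1 Z2 F1 F2 *.
  set u := n%:R `^ al in F1 F2 *.
  have p1 := ler_wpM2l (ltW (lt_le_trans ltr01 a1)) X1.
  have p2 := ler_wpM2l (ltW (lt_le_trans ltr01 a1)) X2.
  have p3 := ler_wpM2l (ltW (lt_le_trans ltr01 b1)) Z1.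
  have p4 := ler_wpM2l (ltW (lt_le_trans ltr01 b1)) Z2.
  have c0' : 0 < c%:R :> R by lra.
  apply/andP; split.
    rewrite -(ler_pM2l c0'); lra.
  rewrite -(ltr_pM2l c0'); lra.
exists (c%:Z * X), (c%:Z * Z), (b%:Z * Z + a%:Z * X); split; [|split; [|split]].
- by split; [exists k|exists m|exists n].
- have x1 : 1 <= c%:Z * X by rewrite -fk floor_ge_int; lra.
  (* The extra 1 in a + c + 1 pays for the rounding of m^al, because k^al >= 1. *)
  have xy : (a%:Z + c%:Z) * (c%:Z * X) < c%:Z * Z.
    rewrite -fk -fm -(ltr_int R) intrM.
    have ac0 : 0 <= a%:R + c%:R :> R by lra.
    have := ler_wpM2l ac0 (floor_le (k%:R `^ al)).
    have := floorD1_gt (m%:R `^ al).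
    rewrite !intrD -!pmulrn; lra.
  apply: (@uniq_of_dominated a b c) => //; ring.
- by ring.
- by rewrite -fk floor_ge_int; exact: le_trans kal.
Qed.


(** While k^al climbs from c X + eta at [al1] to c X + 2 eta at [al2], the factor Q^al >= Q makes (Q
    k)^al climb by at least Q eta >= c, so it meets some c Z + eta on the way. *)
Lemma window_start (c : nat) (k Q al0 eta : R) :
  (0 < c)%N -> 1 < k -> 1 <= Q -> 1 <= al0 -> 0 < eta -> c%:R <= Q * eta ->
  exists (X Z : int) (be : R),
    [/\ al0 <= be, k `^ al0 <= c%:R * X%:~R <= k `^ al0 + c%:R,
        c%:R * X%:~R + eta <= k `^ be <= c%:R * X%:~R + 2 * eta &
        (Q * k) `^ be = c%:R * Z%:~R + eta].
Proof.
move=> c0 k1 Q1 al01 eta0 Qeta.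
have k0 : 0 < k by lra.
have Q0 : 0 < Q by lra.
have K1 : 1 < Q * k by clear -k1 Q1; nra.
have KE x : (Q * k) `^ x = Q `^ x * k `^ x by rewrite powRM// ltW.
have w00 : 0 < k `^ al0 by apply: powR_gt0.
have [X X1 X2] : exists2 X : int, k `^ al0 <= c%:R * X%:~R &
    c%:R * X%:~R <= k `^ al0 + c%:R.
  exists (Num.ceil (k `^ al0 / c%:R)); have /andP[? /ltW ?] := ceilM_itv c (k `^ al0) c0; done.
set w0 := k `^ al0 in w00 X1 X2.
pose w1 := c%:R * X%:~R + eta.
pose al1 := ln w1 / ln k; pose al2 := ln (w1 + eta) / ln k.
have w10 : 0 < w1 by rewrite /w1; clear -w00 eta0 X1; lra.
have kal1 : k `^ al1 = w1 by apply: powR_log.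
have kal2 : k `^ al2 = w1 + eta by apply: powR_log => //; clear -w10 eta0; lra.
pose Y1 := (Q * k) `^ al1.
have [Z Z1 Z2] : exists2 Z : int, Y1 - eta <= c%:R * Z%:~R &
    c%:R * Z%:~R <= Y1 - eta + c%:R.
  exists (Num.ceil ((Y1 - eta) / c%:R)).
    by have /andP[] := ceilM_itv c (Y1 - eta) c0.
  by have /andP[_ /ltW] := ceilM_itv c (Y1 - eta) c0.
have Y10 : 0 < Y1 by apply/powR_gt0/mulr_gt0.
pose be := ln (c%:R * Z%:~R + eta) / ln (Q * k).
have Kbe : (Q * k) `^ be = c%:R * Z%:~R + eta.
  by apply: powR_log => //; clear -Y10 Z1; lra.
have al01' : al0 <= al1.
  by rewrite -(ler_powR_exp k)// kal1 -/w0 /w1; clear -X1 eta0; lra.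
have al1be : al1 <= be.
  by rewrite -(ler_powR_exp (Q * k))// Kbe -/Y1; clear -Z1; lra.
have al12 : al1 <= al2.
  by rewrite -(ler_powR_exp k)// kal1 kal2; clear -eta0; lra.
have beal2 : be <= al2.
  rewrite -(ler_powR_exp (Q * k))// Kbe KE kal2.
  have Y1E : Y1 = Q `^ al1 * w1 by rewrite /Y1 KE kal1.
  have q1 : Q `^ al1 <= Q `^ al2 by rewrite ler_powR.
  have q2 : Q <= Q `^ al1 by apply: le1r_powR => //; exact: le_trans al01'.
  have h1 := ler_wpM2r (ltW w10) q1.
  have h2 := ler_wpM2r (ltW eta0) (le_trans q2 q1).
  clear -Y1E h1 h2 Z2 Qeta; lra.
exists X, Z, be; split => //; first exact: le_trans al1be.
  by rewrite X1 X2.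
rewrite -[c%:R * _ + eta]/w1 -kal1 (ler_powR (ltW k1) al1be)/=.
have -> : c%:R * X%:~R + 2 * eta = w1 + eta by rewrite /w1; ring.
by rewrite -kal2; apply: ler_powR => //; exact: ltW.
Qed.

(** Serves x = k and x = Q k at once, the larger base K dictating the admissible [rho]. *)
Lemma window_stay (x K be rho eta al : R) : 1 <= x -> x <= K -> 1 <= be ->
  eta <= 1 -> 0 <= rho -> 2 * K `^ be * (rho * ln K) <= eta ->
  be <= al <= be + rho -> x `^ be <= x `^ al <= x `^ be + eta.
Proof.
move=> x1 xK be1 eta1 rho0 He /andP[beal albe].
have K1 : 1 <= K by exact: le_trans xK.
have K0 : 0 < K by exact: lt_le_trans K1.
have x0 : 0 < x by exact: lt_le_trans x1.
rewrite ler_powR//=.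
have r0 : 0 <= rho * ln K by rewrite mulr_ge0// ln_ge0.
have Yb1 : 1 <= K `^ be by apply: ge1_powR => //; exact: le_trans be1.
(* With r = rho ln K, the bounds K^rho (1 - r) <= 1 and r <= 1/2 give K^rho <= 1 + 2 r. *)
have Krho : K `^ rho - 1 <= 2 * (rho * ln K).
  have h1 := powR_sub1_le K rho K0; have h2 := ler_wpM2r r0 Yb1.
  clear - h1 h2 He r0 eta1.
  set y := K `^ rho in h1 *; set r := rho * ln K in h1 h2 He r0 *.
  have h3 : y * (1 - r) <= 1 by lra.
  have r1 : 2 * r <= 1 by lra.
  have h4 : 0 <= (1 - r) * (1 + 2 * r) - 1 by clear -r0 r1; nra.
  have r2 : 0 < 1 - r by clear -r1; lra.
  rewrite -(ler_pM2r r2); clear -h3 h4; lra.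
have xt : x `^ (al - be) <= K `^ rho.
  apply: (@le_trans _ _ (K `^ (al - be))).
    by apply: ge0_ler_powR; rewrite ?nnegrE ?subr_ge0// ltW.
  by rewrite ler_powR// lerBlDl.
have xb : x `^ be <= K `^ be.
  apply: ge0_ler_powR => //; rewrite ?nnegrE; [|exact: ltW|exact: ltW].
  exact: le_trans ler01 be1.
have -> : x `^ al = x `^ be * x `^ (al - be) by rewrite -gt0_powRD// subrKC.
have xt1 : 1 <= x `^ (al - be) by apply: ge1_powR => //; rewrite subr_ge0.
have h : x `^ be * (x `^ (al - be) - 1) <= K `^ be * (2 * (rho * ln K)).
  by apply: ler_pM; rewrite ?powR_ge0 ?subr_ge0//; clear -xt Krho; lra.
clear -h He; lra.
Qed.

Lemma window_shift (k al0 al C : R) : 1 < k -> al0 <= al ->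
  k `^ al <= k `^ al0 + C -> al <= al0 + C / (k `^ al0 * ln k).
Proof.
move=> k1 alal0 h; have k0 : 0 < k by exact: lt_trans k1.
have w0 : 0 < k `^ al0 by apply: powR_gt0.
rewrite -lerBlDl ler_pdivlMr ?mulr_gt0 ?ln_gt0//.
have kE : k `^ al = k `^ al0 * k `^ (al - al0) by rewrite -gt0_powRD// subrKC.
have := powR_sub1_ge k (al - al0) k0; rewrite -(ler_pM2l w0) => h1.
by clear -h h1 kE; lra.
Qed.

(** After division by k^al the defect is Lipschitz in al - al0, which is O(1 / (k^al0 ln k));
    multiplying back by k^al, of order k^al0, leaves O(1 / ln k). *)
Lemma window_defect (a b c Q k n v al0 al eta : R) :
  1 <= a -> 1 <= b -> 1 <= c -> c <= Q -> 1 < k -> 0 < n ->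
  1 <= al0 <= v -> al0 <= al ->
  c * (n / k) `^ al0 = b * Q `^ al0 + a ->
  k `^ al <= k `^ al0 + c + 1 -> c + 1 <= ln k ->
  (c + 2) * curve_lip a b Q (v + 1) * (c + 1) <= eta * ln k ->
  `|c * n `^ al - b * (Q * k) `^ al - a * k `^ al| <= eta.
Proof.
move=> a1 b1 c1 cQ k1 n0 /andP[al1 alv] al0al e kal H3 H2.
have k0 : 0 < k by exact: lt_trans k1.
have Q1 : 1 <= Q by exact: le_trans cQ.
have lnk0 : 0 < ln k by exact: ln_gt0.
have w01 : 1 <= k `^ al0 by apply: ge1_powR; [exact: ltW|exact: le_trans al1].
have nu0 : 0 < n / k by rewrite divr_gt0.
have nu1 : 1 <= n / k.
  have al00 : 0 < al0 by exact: lt_le_trans al1.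
  apply: (@ler_powR_inv _ _ _ al0) => //; first exact: ltW.
  have Qal1 : Q <= Q `^ al0 by apply: le1r_powR.
  rewrite powR1 /= -(ler_pM2l (lt_le_trans ltr01 c1)) mulr1 e.
  have bQ : Q `^ al0 <= b * Q `^ al0 by rewrite ler_peMl// powR_ge0.
  by clear -bQ Qal1 a1 cQ; lra.
have h1 : al - al0 <= (c + 1) / (k `^ al0 * ln k).
  by rewrite lerBlDl; apply: window_shift; rewrite ?addrA.
have h2 : al - al0 <= 1.
  apply: le_trans h1 _; rewrite ler_pdivrMr ?mulr_gt0//; last first.
    exact: lt_le_trans w01.
  by rewrite mul1r (le_trans H3)// -[leLHS]mul1r ler_wpM2r// ltW.
have L0 : 0 <= curve_lip a b Q (v + 1).
  rewrite /curve_lip !mulr_ge0 ?powR_ge0 ?ln_ge0//; clear -a1 b1 Q1; nra.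
have nE : n `^ al = (n / k) `^ al * k `^ al.
  by rewrite -powRM ?ltW// divfK// gt_eqF.
have KE : (Q * k) `^ al = Q `^ al * k `^ al.
  by rewrite powRM ?ltW//; exact: lt_le_trans Q1.
have -> : c * n `^ al - b * (Q * k) `^ al - a * k `^ al =
    k `^ al * (c * (n / k) `^ (al0 + (al - al0)) -
               b * Q `^ (al0 + (al - al0)) - a).
  by rewrite subrKC nE KE; ring.
have F : `|c * (n / k) `^ (al0 + (al - al0)) -
           b * Q `^ (al0 + (al - al0)) - a|
    <= curve_lip a b Q (v + 1) * (al - al0).
  apply: curve_upper => //; apply/andP; split=> //.
  - by rewrite (le_trans alv)// lerDl ler01.
  - by rewrite subr_ge0.
  - by clear -h2 alv al1; lra.
rewrite normrM ger0_norm ?powR_ge0//.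
set L := curve_lip _ _ _ _ in H2 L0 F *.
apply: (@le_trans _ _
    (((c + 2) * k `^ al0) * (L * ((c + 1) / (k `^ al0 * ln k))))).
  apply: ler_pM; rewrite ?powR_ge0//; first by clear -kal w01 c1; nra.
  by apply: le_trans F _; rewrite ler_wpM2l.
have -> : (c + 2) * k `^ al0 * (L * ((c + 1) / (k `^ al0 * ln k))) =
   ((c + 2) * L * (c + 1)) / ln k.
  by field; rewrite !gt_eqF//; exact: lt_le_trans w01.
by rewrite ler_pdivrMr.
Qed.

(** The three conditions on k bound the growth of the powers along the window by eta, the defect by
    eta and the shift of the exponent by 1. Starting from margins 2 eta and eta, growth by eta gives
    the margins 3 eta and 2 eta of [floors_solve]. *)
Lemma window (a b c Q k n : nat) (v v2 al0 : R) :
  let eta := (4 * (a%:R + b%:R + 1))^-1 in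
  (0 < a)%N -> (0 < b)%N -> (0 < c)%N -> (1 < k)%N -> (0 < n)%N ->
  2 <= al0 <= v -> a%:R + c%:R + 1 <= Q%:R :> R -> c%:R <= Q%:R * eta ->
  c%:R * (n%:R / k%:R) `^ al0 = b%:R * Q%:R `^ al0 + a%:R ->
  2 * Q%:R `^ (v + 1) * (k%:R `^ v + c%:R + 1) * ln (Q%:R * k%:R)
    * k%:R `^ (- v2) <= eta ->
  (c%:R + 2) * curve_lip a%:R b%:R Q%:R (v + 1) * (c%:R + 1)
    <= eta * ln k%:R ->
  c%:R + 1 <= ln k%:R :> R ->
  exists2 be, al0 <= be <= al0 + (c%:R + 1) / (k%:R `^ al0 * ln k%:R) &
    forall al, be <= al <= be + k%:R `^ (- v2) -> solution_above a b c k al.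
Proof.
move=> eta a0 b0 c0 k1 n0 /andP[al2 alv] Qac Qeta e H1 H2 H3.
have a1 : 1 <= a%:R :> R by rewrite ler1n.
have b1 : 1 <= b%:R :> R by rewrite ler1n.
have c1 : 1 <= c%:R :> R by rewrite ler1n.
have k1' : 1 < k%:R :> R by rewrite ltr1n.
have k0' : 0 < k%:R :> R by exact: lt_trans k1'.
have n0' : 0 < n%:R :> R by rewrite ltr0n.
have Q1 : 1 <= Q%:R :> R by clear -Qac a1 c1; lra.
have Qc : c%:R <= Q%:R :> R by clear -Qac a1; lra.
have eta0 : 0 < eta by rewrite invr_gt0; clear -a1 b1; lra.
have etaE : eta * (4 * (a%:R + b%:R + 1)) = 1.
  by rewrite mulVf// gt_eqF//; clear -a1 b1; lra.
have ea : 0 <= eta * (a%:R - 1) by rewrite mulr_ge0 ?(ltW eta0)// subr_ge0.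
have eb : 0 <= eta * (b%:R - 1) by rewrite mulr_ge0 ?(ltW eta0)// subr_ge0.
have eta12 : 12 * eta <= 1 by clear -etaE ea eb; lra.
have al01 : 1 <= al0 by clear -al2; lra.
have w01 : 1 <= k%:R `^ al0 :> R.
  by apply: ge1_powR; [exact: ltW|exact: le_trans al01].
have [X [Z [be [al0be /andP[X1 X2] /andP[kb1 kb2] Kb]]]] :=
  @window_start c k%:R Q%:R al0 eta c0 k1' Q1 al01 eta0 Qeta.
have be_shift : be <= al0 + (c%:R + 1) / (k%:R `^ al0 * ln k%:R).
  by apply: window_shift => //; clear -kb2 X2 eta12; lra.
exists be; first by rewrite al0be.
move=> al /andP[beal albe].
set rho := k%:R `^ (- v2) in H1 albe.
have rho0 : 0 < rho by apply: powR_gt0.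
have be1 : be <= v + 1.
  apply: le_trans be_shift _; rewrite lerD// ler_pdivrMr ?mulr_gt0 ?ln_gt0//; last first.
    exact: lt_le_trans w01.
  by rewrite mul1r (le_trans H3)// -[leLHS]mul1r ler_wpM2r// ltW ?ln_gt0.
have kK : k%:R <= Q%:R * k%:R :> R by rewrite ler_peMl// ltW.
have K1 : 1 < Q%:R * k%:R :> R by exact: lt_le_trans kK.
have He : 2 * (Q%:R * k%:R) `^ be * (rho * ln (Q%:R * k%:R)) <= eta.
  apply: le_trans H1.
  have Yb1 : (Q%:R * k%:R) `^ be <= Q%:R `^ (v + 1) * (k%:R `^ v + c%:R + 1).
    rewrite powRM; [|exact: ltW (lt_le_trans ltr01 Q1)|exact: ltW].
    rewrite ler_pM ?powR_ge0// ?ler_powR//.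
    have w0v : k%:R `^ al0 <= k%:R `^ v :> R by rewrite ler_powR// ltW.
    by clear -w0v kb2 X2 eta12; lra.
  have r0 : 0 <= rho * ln (Q%:R * k%:R) by rewrite mulr_ge0 ?ln_ge0// ltW.
  have h := ler_wpM2r r0 Yb1.
  by clear -h; lra.
have eta1 : eta <= 1 by clear -eta12 eta0; lra.
have albe' : be <= al <= be + rho by rewrite beal.
have be1' : 1 <= be by exact: le_trans al0be.
have /andP[k1al k2al] := @window_stay k%:R _ _ _ _ _ (ltW k1') kK be1' eta1 (ltW rho0) He albe'.
have /andP[K1al K2al] := @window_stay _ _ _ _ _ _ (ltW K1) (lexx _) be1' eta1 (ltW rho0) He albe'.
have QK : (Q * k)%:R = Q%:R * k%:R :> R by rewrite natrM.
have al1 : 1 <= al by exact: le_trans beal.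
apply: (@floors_solve a b c k (Q * k) n X Z al eta) => //; rewrite ?QK.
- exact: ltnW.
- by rewrite -(ltr0n R) QK mulr_gt0//; exact: lt_le_trans Q1.
- by clear -etaE eta0 ea eb; lra.
- by apply/andP; split; clear -k1al k2al kb1 kb2; lra.
- by rewrite -Kb; apply/andP; split; clear -Kb K1al K2al; lra.
- rewrite powRM; [|exact: ltW (lt_le_trans ltr01 Q1)|exact: ltW].
  rewrite ler_wpM2r ?powR_ge0//; apply: le_trans Qac _.
  exact: le1r_powR.
apply: (@window_defect _ _ _ _ _ _ v al0) => //; first by rewrite al01.
- exact: le_trans beal.
- by clear -kb2 k2al X2 eta12; lra.
Qed.

End Window.

(** * Good exponents in a given interval *)

Section Level.
Context {R : realType}.
Implicit Types x y p q eta v al nu C e : R.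

Lemma near_le_powR C e : 0 < e -> \forall k \near \oo, C <= k%:R `^ e.
Proof.
move=> e0; pose M := (Num.max C 1) `^ e^-1.
have M1 : 0 < Num.max C 1 by rewrite lt_max ltr01 orbT.
near=> k.
have Mk : M <= k%:R by near: k; exact: nbhs_infty_ger.
apply: (@le_trans _ _ (M `^ e)).
  by rewrite -powRrM mulVf ?gt_eqF// powRr1 ?(ltW M1)// le_max lexx.
by apply: ge0_ler_powR Mk; rewrite ?nnegrE ?powR_ge0 ?ler0n ?(ltW e0).
Unshelve. all: end_near. Qed.

Lemma near_le_ln C : \forall k \near \oo, C <= ln (k%:R : R).
Proof.
near=> k.
have Ck : expR C <= k%:R by near: k; exact: nbhs_infty_ger.
rewrite -[leLHS]expRK ler_ln ?posrE ?expR_gt0//.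
exact: lt_le_trans (expR_gt0 _) Ck.
Unshelve. all: end_near. Qed.

Lemma near_window (Q : nat) (v v2 C eta : R) : (0 < Q)%N -> 0 <= v -> v < v2 ->
  0 <= C -> 0 < eta ->
  \forall k \near \oo, 2 * Q%:R `^ (v + 1) * (k%:R `^ v + C) *
    ln (Q%:R * k%:R) * k%:R `^ (- v2) <= eta.
Proof.
(* Half of the gap v2 - v absorbs the logarithm; the other half leaves the decaying factor
   k^(-e). *)
move=> Q0 v0 vv2 C0 eta0; pose e := (v2 - v) / 2.
have e0 : 0 < e by rewrite divr_gt0// subr_gt0.
pose D := 2 * Q%:R `^ (v + 1) * (1 + C) * (Q%:R `^ e / e) / eta.
near=> k.
have Dk : D <= k%:R `^ e by near: k; exact: near_le_powR.
have k0 : (0 < k)%N by near: k; exists 1%N.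
have k1 : 1 <= k%:R :> R by rewrite ler1n.
have k0' : 0 < k%:R :> R by rewrite ltr0n.
have Q0' : 0 < Q%:R :> R by rewrite ltr0n.
have QK0 : 0 < Q%:R * k%:R :> R by rewrite mulr_gt0.
have lnle : ln (Q%:R * k%:R) <= Q%:R `^ e / e * k%:R `^ e.
  have := powR_sub1_ge (Q%:R * k%:R) e QK0; rewrite powRM ?ler0n// => h.
  have -> : Q%:R `^ e / e * k%:R `^ e = Q%:R `^ e * k%:R `^ e / e by ring.
  rewrite ler_pdivlMr// mulrC; clear -h; lra.
have kv1 : 1 <= k%:R `^ v by apply: ge1_powR.
have kC : k%:R `^ v + C <= (1 + C) * k%:R `^ v.
  have h := ler_wpM2l C0 kv1; clear -h; lra.
have ke0 : 0 < k%:R `^ e by apply: powR_gt0.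
have kE : k%:R `^ v * k%:R `^ e * k%:R `^ (- v2) = (k%:R `^ e)^-1.
  by rewrite -powRN -!gt0_powRD//; congr (_ `^ _); rewrite /e; field.
have Qv0 : 0 <= 2 * Q%:R `^ (v + 1) :> R by rewrite mulr_ge0// powR_ge0.
have QK1 : 1 <= Q%:R * k%:R :> R.
  by rewrite -natrM ler1n muln_gt0 Q0.
apply: (@le_trans _ _ (2 * Q%:R `^ (v + 1) * ((1 + C) * k%:R `^ v) *
    (Q%:R `^ e / e * k%:R `^ e) * k%:R `^ (- v2))).
  rewrite ler_wpM2r ?powR_ge0// ler_pM// ?ln_ge0//; last by rewrite ler_wpM2l.
  by rewrite mulr_ge0// addr_ge0// powR_ge0.
have -> : 2 * Q%:R `^ (v + 1) * ((1 + C) * k%:R `^ v) *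
    (Q%:R `^ e / e * k%:R `^ e) * k%:R `^ (- v2) =
    (D * eta) * (k%:R `^ v * k%:R `^ e * k%:R `^ (- v2)).
  by rewrite /D divfK ?gt_eqF//; ring.
by rewrite kE ler_pdivrMr// mulrC ler_pM2l.
Unshelve. all: end_near. Qed.

Definition curve_ratio a b c Q al := ((b * Q `^ al + a) / c) `^ al^-1 : R.

Lemma curve_ratioP a b c Q al : 0 < a -> 0 < b -> 0 < c -> 0 < al ->
  c * curve_ratio a b c Q al `^ al = b * Q `^ al + a.
Proof.
move=> a0 b0 c0 al0; rewrite -powRrM mulVf ?gt_eqF// powRr1; last first.
  by rewrite divr_ge0 ?addr_ge0 ?mulr_ge0 ?powR_ge0 ?(ltW a0) ?(ltW b0) ?(ltW c0).
by rewrite mulrC divfK// gt_eqF.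
Qed.

Lemma curve_ratio_ge1 a b c Q al : 1 <= a -> 1 <= b -> 0 < c -> c <= Q -> 1 <= Q ->
  1 <= al -> 1 <= curve_ratio a b c Q al.
Proof.
move=> a1 b1 c0 cQ Q1 al1; apply: ge1_powR; last by rewrite invr_ge0; lra.
rewrite ler_pdivlMr// mul1r.
have := le1r_powR Q1 al1; nra.
Qed.

Lemma continuous_powR_exp x : 0 < x -> continuous (fun p => x `^ p).
Proof.
move=> x0 p; have -> : (fun p => x `^ p) = (fun p => expR (p * ln x)).
  by apply/funext => q; rewrite powRE.
apply: continuous_comp; last exact: continuous_expR.
by apply: cvgM; [exact: cvg_id|exact: cvg_cst].
Qed.

(** Intermediate value theorem: c nu^al - b Q^al - a has the sign of nu minus [curve_ratio] at [al].
    The minimum and maximum cover ratios that rise or fall with the exponent. *)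
Lemma curve_root a b c Q u v nu :
  0 < a -> 0 < b -> 0 < c -> 0 < Q -> 0 < u -> u <= v ->
  0 < nu ->
  Num.min (curve_ratio a b c Q u) (curve_ratio a b c Q v) <= nu <=
  Num.max (curve_ratio a b c Q u) (curve_ratio a b c Q v) ->
  exists2 al, u <= al <= v & c * nu `^ al = b * Q `^ al + a.
Proof.
move=> a0 b0 c0 Q0 u0 uv nu0 h.
pose f al := c * nu `^ al - b * Q `^ al.
have f_cont : continuous f.
  move=> x; apply: cvgB; (apply: cvgM; [exact: cvg_cst|exact: continuous_powR_exp]).
have fE al : 0 < al ->
    f al - a = c * (nu `^ al - curve_ratio a b c Q al `^ al).
  by move=> al0; rewrite mulrBr curve_ratioP// /f; ring.
have v0 : 0 < v by exact: lt_le_trans uv.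
have F1 al : 0 < al -> nu <= curve_ratio a b c Q al -> f al <= a.
  move=> al0 le; rewrite -subr_le0 fE// pmulr_rle0// subr_le0.
  by apply: ge0_ler_powR le; rewrite ?nnegrE ?powR_ge0 ?(ltW al0) ?(ltW nu0).
have F2 al : 0 < al -> curve_ratio a b c Q al <= nu -> a <= f al.
  move=> al0 le; rewrite -subr_ge0 fE// pmulr_rge0// subr_ge0.
  by apply: ge0_ler_powR le; rewrite ?nnegrE ?powR_ge0 ?(ltW al0) ?(ltW nu0).
have [|al aluv fal] := @IVT _ f u v a uv (continuous_subspaceT f_cont).
  move: h; rewrite !ge_min !le_max => /andP[/orP h1 /orP h2].
  apply/andP; split.
    by case: h2 => h2; [rewrite (F1 _ u0 h2)|rewrite (F1 _ v0 h2) orbT].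
  by case: h1 => h1; [rewrite (F2 _ u0 h1)|rewrite (F2 _ v0 h1) orbT].
exists al; first by move: aluv; rewrite in_itv.
by move: fal; rewrite /f => <-; ring.
Qed.

Lemma powR_dist_le x y B p v : 1 <= x <= B -> 1 <= y <= B -> 1 <= p <= v ->
  `|x - y| <= `|x `^ p - y `^ p| <= v * B `^ v * `|x - y|.
Proof.
wlog yx : x y / y <= x => [H hx hy hp|].
  have [yx|/ltW xy] := leP y x; first exact: H.
  by rewrite distrC (distrC (x `^ p)); apply: H.
move=> /andP[x1 xB] /andP[y1 yB] /andP[p1 pv].
have p0 : 0 <= p by lra.
rewrite !ger0_norm ?subr_ge0//; last first.
  by apply: ge0_ler_powR; rewrite ?nnegrE//; lra.
rewrite powR_sub_ge//=; apply: le_trans (powR_sub_le _ _ _ y1 yx p0) _.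
rewrite ler_wpM2r ?subr_ge0// ler_pM ?powR_ge0//.
apply: (@le_trans _ _ (x `^ v)); first by rewrite ler_powR.
by apply: ge0_ler_powR; rewrite ?nnegrE//; lra.
Qed.

(** At [be] the defect of nu' is 0 and that of nu is at most L (be - al). They differ by c (nu^be -
    nu'^be), which controls nu - nu' since powers with exponent at least 1 expand distances on [1,
    oo). *)
Lemma root_separation a b c Q v nu nu' al be :
  1 <= a -> 1 <= b -> 1 <= c -> 1 <= Q -> 1 <= nu -> 1 <= nu' ->
  1 <= al -> al <= be <= v ->
  c * nu `^ al = b * Q `^ al + a -> c * nu' `^ be = b * Q `^ be + a ->
  `|nu - nu'| <= curve_lip a b Q v * (be - al).
Proof.
move=> a1 b1 c1 Q1 n1 n1' al1 /andP[albe bev] e e'.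
have alv : 1 <= al <= v by rewrite al1 (le_trans albe).
have h0 : 0 <= be - al <= v by apply/andP; split; lra.
have := @curve_upper _ a b c Q v nu al (be - al) a1 b1 c1 Q1 n1 alv h0 e.
rewrite subrKC; apply: le_trans.
have nuB : nu <= (a + b) * Q.
  by apply: curve_le e => //; exact: lt_le_trans n1.
have nuB' : nu' <= (a + b) * Q.
  by apply: curve_le e' => //; [exact: lt_le_trans n1'|exact: le_trans albe].
have /andP[h _] : `|nu - nu'| <= `|nu `^ be - nu' `^ be| <=
    be * ((a + b) * Q) `^ be * `|nu - nu'|.
  by apply: powR_dist_le; [rewrite n1|rewrite n1'|rewrite lexx andbT; lra].
apply: le_trans h _.
have -> : c * nu `^ be - b * Q `^ be - a = c * (nu `^ be - nu' `^ be).
  by rewrite mulrBr e'; ring.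
by rewrite normrM (ger0_norm (x := c)) ?ler_peMl//; lra.
Qed.

(** Opposite to [root_separation]: the defect of nu at al + h is at least h / 2, while powers are
    Lipschitz on [1, B]. This makes the number of admissible n proportional to k. *)
Lemma curve_ratio_spread a b c Q v al h :
  1 <= a -> 1 <= b -> 1 <= c -> c <= Q -> 3 <= Q -> 2 * a <= Q ->
  2 * c * v * (a + 1) <= Q -> c <= b \/ b + 1 <= c ->
  2 <= al -> 0 <= h -> al + h <= v ->
  h / (2 * c * v * ((a + b) * Q) `^ v) <=
    `|curve_ratio a b c Q al - curve_ratio a b c Q (al + h)|.
Proof.
move=> a1 b1 c1 cQ Q3 aQ vQ bc al2 h0 ahv.
have Q1 : 1 <= Q by lra.
have al1 : 1 <= al by lra.
have be1 : 1 <= al + h by lra.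
have c0 : 0 < c by lra.
have v0 : 0 < v by lra.
set nu := curve_ratio a b c Q al; set nu' := curve_ratio a b c Q (al + h).
have n1 : 1 <= nu by apply: curve_ratio_ge1.
have n1' : 1 <= nu' by apply: curve_ratio_ge1.
have e : c * nu `^ al = b * Q `^ al + a.
  by apply: curve_ratioP => //; exact: lt_le_trans ltr01 _.
have e' : c * nu' `^ (al + h) = b * Q `^ (al + h) + a.
  by apply: curve_ratioP => //; exact: lt_le_trans ltr01 _.
clearbody nu nu'.
have nuB : nu <= (a + b) * Q.
  by apply: curve_le e => //; exact: lt_le_trans n1.
have nuB' : nu' <= (a + b) * Q.
  by apply: curve_le e' => //; exact: lt_le_trans n1'.
have alv : 2 <= al <= v by rewrite al2/=; clear -h0 ahv; lra.
have := @curve_lower _ a b c Q v nu al h a1 b1 c1 n1 alv h0 Q3 aQ vQ bc e.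
have -> : c * nu `^ (al + h) - b * Q `^ (al + h) - a =
    c * (nu `^ (al + h) - nu' `^ (al + h)) by rewrite mulrBr e'; ring.
rewrite normrM (ger0_norm (x := c)) ?(ltW c0)// => lo.
have /andP[_ up] : `|nu - nu'| <= `|nu `^ (al + h) - nu' `^ (al + h)| <=
    v * ((a + b) * Q) `^ v * `|nu - nu'|.
  by apply: powR_dist_le; rewrite ?n1 ?n1' ?be1.
have B0 : 0 < ((a + b) * Q) `^ v by apply: powR_gt0; clear -a1 b1 Q1; nra.
rewrite ler_pdivrMr ?mulr_gt0//.
have := ler_wpM2l (ltW c0) up.
by clear -lo; lra.
Qed.

Lemma dist_max_min x y : `|x - y| = Num.max x y - Num.min x y.
Proof.
by case: leP => xy; [rewrite distrC ger0_norm|rewrite gtr0_norm];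
  rewrite ?subr_ge0 ?subr_gt0.
Qed.

Lemma natr_dist_ge1 (i j : nat) : i != j -> 1 <= `|i%:R - j%:R| :> R.
Proof.
by case: (ltngtP i j) => // ij _; [rewrite distrC|];
  rewrite -natrB ?(ltnW ij)// normr_nat ler1n subn_gt0.
Qed.

(** The candidates are n = n0 + j, with n / k between the values of [curve_ratio] at two exponents.
    In the factor 8, one 2 comes from halving the interval, one from [curve_ratio_spread] and one
    from rounding down to [M]. *)
Lemma level (a b c Q : nat) (u v w v2 : R) :
  let eta : R := (4 * (a%:R + b%:R + 1))^-1 in
  let B : R := (a%:R + b%:R) * Q%:R in
  let L : R := curve_lip a%:R b%:R Q%:R w in
  (0 < a)%N -> (0 < b)%N -> (0 < c)%N ->
  a%:R + c%:R + 3 <= Q%:R :> R -> 2 * a%:R <= Q%:R :> R ->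
  c%:R <= Q%:R * eta -> 2 * c%:R * w * (a%:R + 1) <= Q%:R ->
  2 <= u -> u < v -> v <= w -> w < v2 ->
  \forall k \near \oo, exists (M : nat) (be : nat -> R),
    [/\ (v - u) / (8 * c%:R * w * B `^ w) * k%:R <= M%:R,
        forall j, (j < M)%N -> u <= be j /\ be j + k%:R `^ (- v2) <= v,
        forall j al, (j < M)%N -> be j <= al <= be j + k%:R `^ (- v2) ->
          solution_above a b c k al &
        forall i j x y, (i < M)%N -> (j < M)%N -> i != j ->
          be i <= x <= be i + k%:R `^ (- v2) ->
          be j <= y <= be j + k%:R `^ (- v2) ->
          `|i%:R - j%:R| <= 2 * L * k%:R * `|x - y| ].
Proof.
move=> eta B L a0 b0 c0 Qac Qa Qeta Qw u2 uv vw wv2.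
have a1 : 1 <= a%:R :> R by rewrite ler1n.
have b1 : 1 <= b%:R :> R by rewrite ler1n.
have c1 : 1 <= c%:R :> R by rewrite ler1n.
have c0' : 0 < c%:R :> R by rewrite ltr0n.
have cQ : c%:R <= Q%:R :> R by clear -Qac a1; lra.
have Q3 : 3 <= Q%:R :> R by clear -Qac a1 c1; lra.
have Q1 : 1 <= Q%:R :> R by clear -Q3; lra.
have Q0 : 0 < Q%:R :> R by clear -Q3; lra.
have w2 : 2 < w by exact: le_lt_trans u2 (lt_le_trans uv vw).
have w0 : 0 < w by clear -w2; lra.
have eta0 : 0 < eta by rewrite invr_gt0; clear -a1 b1; lra.
have bc : c%:R <= b%:R :> R \/ b%:R + 1 <= c%:R :> R.
  by rewrite natr1 !ler_nat; case: (leqP c b); [left|right].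
(* Roots are sought in the left half; the right half leaves room for the windows. *)
pose h := (v - u) / 2.
have h0 : 0 < h by rewrite divr_gt0// subr_gt0.
have vE : v = u + h + h by rewrite /h; field.
have uhw : u + h <= w by clear -vE h0 vw; lra.
pose r1 := curve_ratio a%:R b%:R c%:R Q%:R u.
pose r2 := curve_ratio a%:R b%:R c%:R Q%:R (u + h).
have r11 : 1 <= r1 by apply: curve_ratio_ge1 => //; clear -u2; lra.
have r21 : 1 <= r2 by apply: curve_ratio_ge1 => //; clear -u2 h0; lra.
have spread : h / (2 * c%:R * w * B `^ w) <= `|r1 - r2|.
  by apply: curve_ratio_spread => //; exact: ltW.
have B0 : 0 < B by rewrite /B mulr_gt0// addr_gt0// ltr0n.
have Bw0 : 0 < B `^ w by apply: powR_gt0.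
have L0 : 0 <= L.
  rewrite /L /curve_lip !mulr_ge0 ?powR_ge0 ?ln_ge0//; clear -a1 b1 Q1; nra.
pose y1 := Num.min r1 r2; pose y2 := Num.max r1 r2.
have y11 : 1 <= y1.
  by rewrite /y1 le_min; apply/andP; split; [exact: r11|exact: r21].
have y12 : h / (2 * c%:R * w * B `^ w) <= y2 - y1 by rewrite -dist_max_min.
near=> k.
have k1 : (1 < k)%N by near: k; exists 2%N.
have H1 : 2 * Q%:R `^ (w + 1) * (k%:R `^ w + (c%:R + 1)) *
    ln (Q%:R * k%:R) * k%:R `^ (- v2) <= eta.
  near: k; apply: near_window => //; [by rewrite -(ltr0n R)|exact: ltW].
have H2 : (c%:R + 2) * curve_lip a%:R b%:R Q%:R (w + 1) * (c%:R + 1) / eta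
    <= ln k%:R by near: k; exact: near_le_ln.
have H3 : c%:R + 1 <= ln k%:R :> R by near: k; exact: near_le_ln.
have H4 : 2 / (h / (2 * c%:R * w * B `^ w)) <= k%:R by near: k; exact: nbhs_infty_ger.
have H5 : 2 / h <= k%:R by near: k; exact: nbhs_infty_ger.
have H6 : 4 * L <= k%:R by near: k; exact: nbhs_infty_ger.
have k1' : 1 < k%:R :> R by rewrite ltr1n.
have k0' : 0 < k%:R :> R by exact: lt_trans k1'.
pose M := Num.truncn (k%:R * (y2 - y1)).
have y12' : 0 <= y2 - y1.
  by apply: le_trans y12; rewrite divr_ge0 ?(ltW h0)// !mulr_ge0// ltW.
have /andP[M1 M2] : M%:R <= k%:R * (y2 - y1) < M.+1%:R.
  by apply: truncn_itv; rewrite mulr_ge0// ltW.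
pose n0 := `|Num.ceil (k%:R * y1)|%N.
have n0y : k%:R * y1 <= n0%:R <= k%:R * y1 + 1.
  have ky0 : 0 < k%:R * y1 by rewrite mulr_gt0//; exact: lt_le_trans y11.
  rewrite /n0 natr_absz ger0_norm; last by rewrite ceil_ge0 (lt_trans _ ky0)// ltrN10.
  have /andP[] := ceil_itv (k%:R * y1); rewrite intrD => p1 p2.
  by rewrite p2/=; clear -p1; lra.
have nuj j : (j < M)%N -> y1 <= (n0 + j)%:R / k%:R <= y2.
  move=> jM; rewrite ler_pdivlMr// ler_pdivrMr// natrD.
  have j1 : j%:R + 1 <= M%:R :> R by rewrite natr1 ler_nat.
  have j0 : 0 <= j%:R :> R by [].
  move: n0y => /andP[p1 p2]; apply/andP; split; first by clear -p1 j0; lra.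
  by clear -p2 j1 M1; lra.
(* Stated under j < M, with a dummy exponent beyond, so that [choice] yields a function on all
   indices. *)
have root j : exists al, (j < M)%N -> u <= al <= u + h /\
    c%:R * ((n0 + j)%:R / k%:R) `^ al = b%:R * Q%:R `^ al + a%:R.
  have [jM|_] := ltnP j M; last by exists u.
  have u0 : 0 < u by exact: lt_le_trans u2.
  have uh : u <= u + h by rewrite lerDl ltW.
  have nu0 : 0 < (n0 + j)%:R / k%:R :> R.
    by have /andP[p _] := nuj j jM; apply: lt_le_trans (le_trans y11 p).
  have [al alu e] := @curve_root _ _ _ _ _ _ _ (lt_le_trans ltr01 a1)
    (lt_le_trans ltr01 b1) c0' Q0 u0 uh nu0 (nuj j jM).
  by exists al.
have [al0 al0P] := choice root.
have kinv : k%:R ^- 2 <= k%:R^-1 :> R.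
  rewrite lef_pV2 ?posrE ?exprn_gt0// expr2 ler_peMl// ltW//.
have win j : exists be, (j < M)%N -> al0 j <= be <= al0 j + k%:R ^- 2 /\
    forall al, be <= al <= be + k%:R `^ (- v2) -> solution_above a b c k al.
  have [jM|_] := ltnP j M; last by exists u.
  have [/andP[ual alh] e] := al0P j jM.
  have al2 : 2 <= al0 j by exact: le_trans ual.
  have al2w : 2 <= al0 j <= w by rewrite al2 (le_trans alh).
  have nj0 : (0 < n0 + j)%N.
    rewrite -(ltr0n R).
    have := nuj j jM; rewrite ler_pdivlMr// => /andP[p _].
    by apply: lt_le_trans p; rewrite mulr_gt0// (lt_le_trans ltr01 y11).
  have Qac1 : a%:R + c%:R + 1 <= Q%:R :> R by clear -Qac; lra.
  have H1' : 2 * Q%:R `^ (w + 1) * (k%:R `^ w + c%:R + 1) * ln (Q%:R * k%:R)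
    * k%:R `^ (- v2) <= eta by rewrite -(addrA (_ `^ w)).
  have H2' : (c%:R + 2) * curve_lip a%:R b%:R Q%:R (w + 1) * (c%:R + 1)
    <= eta * ln k%:R by rewrite [leRHS]mulrC -ler_pdivrMr.
  have [be /andP[be1 be2] sol] := @window _ a b c Q k (n0 + j) w v2 (al0 j)
    a0 b0 c0 k1 nj0 al2w Qac1 Qeta e H1' H2' H3.
  exists be => _; split => //; rewrite be1; apply: le_trans be2 _.
  rewrite lerD2l; have k2 : k%:R ^+ 2 <= k%:R `^ al0 j.
    by rewrite -powR_mulrn ?ler_powR// ltW.
  have lk0 : 0 < ln k%:R :> R by apply: lt_le_trans H3; rewrite addr_gt0.
  have ka0 : 0 < k%:R `^ al0 j by apply: powR_gt0.
  rewrite ler_pdivrMr ?mulr_gt0// mulrA.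
  have p : 1 <= k%:R ^- 2 * k%:R `^ al0 j.
    by rewrite mulrC ler_pdivlMr ?exprn_gt0// mul1r.
  by apply: le_trans H3 _; rewrite ler_peMl// ltW.
have [be beP] := choice win.
have kv2 : k%:R `^ (- v2) <= k%:R ^- 2.
  rewrite powRN lef_pV2 ?posrE ?exprn_gt0 ?powR_gt0// -powR_mulrn ?ler_powR//.
    exact: ltW.
  by rewrite (le_trans (ltW w2))// ltW.
exists M, be; split.
- have T0 : 0 < h / (2 * c%:R * w * B `^ w) by rewrite divr_gt0// !mulr_gt0.
  have -> : (v - u) / (8 * c%:R * w * B `^ w) =
      h / (2 * c%:R * w * B `^ w) / 2.
    by rewrite /h; field; rewrite !gt_eqF.
  move: T0 y12 H4 M2; set T := h / _ => T0 y12 H4 M2.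
  move: H4; rewrite ler_pdivrMr// => H4.
  have := ler_wpM2l (ltW k0') y12.
  move: M2; rewrite -natr1; clear -H4; lra.
- move=> j jM; have [/andP[p1 p2] _] := al0P j jM.
  have [/andP[p3 p4] _] := beP j jM; split; first exact: le_trans p3.
  have p5 : 2 * k%:R^-1 <= h by rewrite ler_pdivrMr// mulrC -ler_pdivrMr.
  by rewrite vE; clear -p2 p4 p5 kinv kv2; lra.
- by move=> j al jM; apply: (proj2 (beP j jM)).
(* Points of a window lie within 2 k^(-2) of its root. The resulting error L k (2 k^(-2)) is at most
   1/2, hence at most half of |i - j|, which doubles the constant. *)
have sep i j x y : (i < M)%N -> (j < M)%N -> i != j -> al0 i <= al0 j ->
    be i <= x <= be i + k%:R `^ (- v2) ->
    be j <= y <= be j + k%:R `^ (- v2) ->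
    `|i%:R - j%:R| <= 2 * L * k%:R * `|x - y|.
  move=> iM jM ij alij /andP[x1 x2] /andP[z1 z2].
  have [/andP[ui _] ei] := al0P i iM; have [/andP[_ jh] ej] := al0P j jM.
  have [/andP[p1 p2] _] := beP i iM; have [/andP[p3 p4] _] := beP j jM.
  have /andP[ni _] := nuj i iM; have /andP[nj _] := nuj j jM.
  have ali1 : 1 <= al0 i.
    by apply: le_trans ui; apply: le_trans u2; rewrite ler1n.
  have aljw : al0 i <= al0 j <= w by rewrite alij (le_trans jh).
  have := @root_separation _ _ _ _ w _ _ _ _ a1 b1 c1 Q1 (le_trans y11 ni)
    (le_trans y11 nj) ali1 aljw ei ej.
  rewrite -/L -mulrBl !natrD normrM (ger0_norm (x := k%:R^-1)) ?invr_ge0 ?ler0n//.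
  have -> : n0%:R + i%:R - (n0%:R + j%:R) = i%:R - j%:R :> R by ring.
  rewrite ler_pdivrMr// => q.
  have ij1 := natr_dist_ge1 _ _ ij.
  have d : al0 j - al0 i <= `|x - y| + 2 * k%:R ^- 2.
    rewrite distrC; have := ler_norm (y - x).
    by clear -x1 x2 z1 z2 p1 p2 p3 p4 kv2; lra.
  have Lk0 : 0 <= L * k%:R by rewrite mulr_ge0.
  have q2 : L * k%:R * (2 * k%:R ^- 2) <= 2^-1.
    have -> : L * k%:R * (2 * k%:R ^- 2) = 2 * L / k%:R.
      by field; rewrite gt_eqF.
    by rewrite ler_pdivrMr//; clear -H6; lra.
  have := ler_wpM2l Lk0 d; clear -q q2 ij1.
  by lra.
move=> i j x y iM jM ij xi yj; have [alij|/ltW alji] := leP (al0 i) (al0 j).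
  exact: sep.
by rewrite distrC (distrC x); apply: sep => //; rewrite eq_sym.
Unshelve. all: end_near. Qed.

End Level.

(** * Avoiding a light cover *)

Section Avoid.
Context {R : realType}.

(** All indices in [P] lie between the smallest m and the largest n, so there are at most n - m + 1
    of them. *)
Lemma count_clustered (M : nat) (P : pred nat) (D : R) : 0 <= D ->
  (forall i j, (i < M)%N -> (j < M)%N -> i != j -> P i -> P j ->
    `|i%:R - j%:R| <= D) ->
  \sum_(j < M | P j) 1 <= D + 1.
Proof.
move=> D0 H; pose s := [seq j <- iota 0 M | P j].
have sumE : \sum_(j < M | P j) 1 = (size s)%:R :> R.
  rewrite -(big_mkord P (fun=> 1)) /s size_filter -sum1_count natr_sum.
  by rewrite /index_iota subn0.
have memE j : (j \in s) = (P j && (j < M)%N) by rewrite mem_filter mem_iota.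
have [s0|s0] := posnP (size s); first by rewrite sumE s0 addr_ge0.
have ex0 : exists j, j \in s by exists (nth 0%N s 0); exact: mem_nth.
have ub j : j \in s -> (j <= M)%N by rewrite memE => /andP[_ /ltnW].
case: (ex_minnP ex0) => m ms mmin.
case: (ex_maxnP ex0 ub) => n ns nmax.
have mn : (m <= n)%N by exact: mmin.
have size_le : (size s <= (n - m).+1)%N.
  rewrite -(size_iota m (n - m).+1); apply: uniq_leq_size.
    by rewrite filter_uniq// iota_uniq.
  move=> j js; rewrite mem_iota mmin//= addnS ltnS subnKC//; exact: nmax.
rewrite sumE; apply: (@le_trans _ _ (n - m).+1%:R); first by rewrite ler_nat.
rewrite -natr1 lerD2r natrB//.
have [<-|nm] := eqVneq m n; first by rewrite subrr.
move: ms ns; rewrite !memE => /andP[Pm mM] /andP[Pn nM].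
apply: le_trans (H n m nM mM _ Pn Pm); first exact: ler_norm.
by rewrite eq_sym.
Qed.

(** Averaging: were every child to carry more than T, the weights min(w i, T) summed over all
    children would reach M T. Member i meets at most D r i + 1 children, so it contributes at most w
    i + T D r i, and the total stays below M T. *)
Lemma select_child (M : nat) (D T S rho : R) (w r : nat -> R) (q : pred nat)
    (meets : nat -> pred nat) :
  (forall i, 0 <= w i) -> (forall i, 0 <= r i) -> 0 < T -> 0 <= D ->
  (forall i j, (j < M)%N -> meets i j -> q i) ->
  (forall i j j', (j < M)%N -> (j' < M)%N -> j != j' ->
     meets i j -> meets i j' -> `|j%:R - j'%:R| <= D * r i) ->
  (forall N, \sum_(i < N | q i) w i <= S) ->
  (forall N, \sum_(i < N | q i) r i <= rho) ->
  S + T * D * rho < M%:R * T ->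
  exists2 j, (j < M)%N & forall N, \sum_(i < N | meets i j) w i <= T.
Proof.
move=> w0 r0 T0 D0 mq cl wS rrho ineq.
apply: contrapT => nex.
have big j : exists N, (j < M)%N -> T < \sum_(i < N | meets i j) w i.
  have [jM|_] := ltnP j M; last by exists 0%N.
  apply: contrapT => nN; apply: nex; exists j => // N.
  by rewrite leNgt; apply/negP => lt; apply: nN; exists N.
have [Nf NfP] := choice big.
(* One finite horizon at which all M children are already too heavy. *)
pose N := (\max_(j < M) Nf j)%N.
pose w' i := Num.min (w i) T.
have w'0 i : 0 <= w' i by rewrite le_min w0 ltW.
have child j : (j < M)%N -> T <= \sum_(i < N | meets i j) w' i.
  move=> jM.
  have jN : (Nf j <= N)%N by exact: (leq_bigmax (Ordinal jM)).
  have sT : T < \sum_(i < N | meets i j) w i.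
    apply: lt_le_trans (NfP j jM) _.
    rewrite -!(big_mkord (fun i => meets i j)) (big_cat_nat _ jN)//= lerDl.
    exact: sumr_ge0.
  (* Truncation keeps the sum at least T: either one member reaches T by itself, or none is
     truncated. *)
  have [[i /andP[mi wi]]|none] := pselect (exists i : 'I_N, meets i j && (T <= w i)).
    rewrite (bigD1 i)//= {1}/w' (min_idPr wi) lerDl.
    by apply: sumr_ge0.
  rewrite (eq_bigr (fun i : 'I_N => w i)); first exact: ltW.
  move=> i mi.
  apply/min_idPl; rewrite leNgt; apply/negP => lt; apply: none.
  by exists i; rewrite mi ltW.
have : M%:R * T <= \sum_(j < M) \sum_(i < N | meets i j) w' i.
  rewrite mulr_natl -[X in T *+ X]card_ord -sumr_const.
  by apply: ler_sum => j _; exact: child.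
(* The truncated weights keep large members of the cover, which meet many
   children, from dominating the average. *)
rewrite (exchange_big_dep (fun i : 'I_N => q i)) /=; last first.
  by move=> j i _; exact: mq.
apply/negP; rewrite -ltNge; apply: le_lt_trans ineq.
apply: (@le_trans _ _ (\sum_(i < N | q i) (w i + T * D * r i))).
  apply: ler_sum => i _.
  rewrite (eq_bigr (fun j => w' i * 1)) => [|j _]; last by rewrite mulr1.
  rewrite -mulr_sumr.
  have := @count_clustered M (meets i) (D * r i) (mulr_ge0 D0 (r0 i)) (cl i).
  move=> /(ler_wpM2l (w'0 i)) h; apply: le_trans h _.
  rewrite mulrDr mulr1 addrC lerD ?ge_min ?lexx// mulrA ler_wpM2r//.
  by rewrite ler_wpM2r// ge_min lexx orbT.
rewrite big_split /= -mulr_sumr; apply: lerD; first exact: wS.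
by apply: ler_wpM2l; [rewrite mulr_ge0// ltW|exact: rrho].
Qed.

(** Each summed w i is at most S^d, and 1/d - 1 >= 0, so w i^(1/d) is at most w i times (S^d)^(1/d -
    1). *)
Lemma sum_powR_inv (d S : R) (q : pred nat) (w : nat -> R) (N : nat) :
  0 < d <= 1 -> 0 <= S -> (forall i, 0 <= w i) ->
  \sum_(i < N | q i) w i <= S `^ d ->
  \sum_(i < N | q i) w i `^ d^-1 <= S.
Proof.
move=> /andP[d0 d1] S0 w0 wS.
have e0 : 0 <= d^-1 - 1 by rewrite subr_ge0 invf_ge1.
have dV : d^-1 = 1 + (d^-1 - 1) by rewrite subrKC.
have split x : 0 <= x -> x `^ d^-1 = x * x `^ (d^-1 - 1).
  by move=> x0; rewrite mulr_powRB1// invr_gt0.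
have -> : S = S `^ d * (S `^ d) `^ (d^-1 - 1).
  by rewrite -split ?powR_ge0// -powRrM mulfV ?gt_eqF// powRr1.
apply: (@le_trans _ _ (\sum_(i < N | q i) w i * (S `^ d) `^ (d^-1 - 1))).
  apply: ler_sum => i qi; rewrite split// ler_wpM2l//.
  apply: ge0_ler_powR; rewrite ?nnegrE ?powR_ge0//.
  apply: le_trans wS; rewrite (bigD1 i)//= lerDl; exact: sumr_ge0.
by rewrite -mulr_suml ler_wpM2r// powR_ge0.
Qed.

Definition hits (U : (set R)^nat) (u v : R) (i : nat) : bool :=
  `[< exists2 x, U i x & u <= x <= v >].

(** The form in which [level] enters the covering argument, with [kappa] and [L] uniform over all
    subintervals of [u0, v0]. *)
Definition branching (Sol : nat -> R -> Prop) (u0 v0 v2 kappa L : R) : Prop :=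
  forall u v, u0 <= u -> u < v -> v <= v0 ->
  \forall k \near \oo, exists (M : nat) (be : nat -> R),
    [/\ kappa * (v - u) * k%:R <= M%:R,
        forall j, (j < M)%N -> u <= be j /\ be j + k%:R `^ (- v2) <= v,
        forall j al, (j < M)%N -> be j <= al <= be j + k%:R `^ (- v2) ->
          Sol k al &
        forall i j x y, (i < M)%N -> (j < M)%N -> i != j ->
          be i <= x <= be i + k%:R `^ (- v2) ->
          be j <= y <= be j + k%:R `^ (- v2) ->
          `|i%:R - j%:R| <= L * k%:R * `|x - y| ].

(* Since w i `^ d^-1 bounds the diameter of U i, the weight invariant also bounds
   the total length of the members meeting the interval by theta times its
   length. *)
Lemma avoid_step Sol (u0 v0 v2 kappa L d u v : R) (U : (set R)^nat)
    (w : nat -> R) :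
  let theta := kappa / (4 * L) in
  branching Sol u0 v0 v2 kappa L -> 0 < kappa -> 0 < L -> 0 < d <= 1 ->
  d * v2 < 1 -> (forall i, 0 <= w i) ->
  (forall i x y, U i x -> U i y -> `|x - y| <= w i `^ d^-1) ->
  u0 <= u -> u < v -> v <= v0 ->
  (forall N, \sum_(i < N | hits U u v i) w i <= (theta * (v - u)) `^ d) ->
  \forall k \near \oo, exists u',
    [/\ u <= u', u' + k%:R `^ (- v2) <= v,
        forall al, u' <= al <= u' + k%:R `^ (- v2) -> Sol k al &
        forall N, \sum_(i < N | hits U u' (u' + k%:R `^ (- v2)) i) w i <=
          (theta * k%:R `^ (- v2)) `^ d].
Proof.
move=> theta br ka0 L0 d01 dv2 w0 Uw u0u uv vv0 load.
have rho0 : 0 < v - u by rewrite subr_gt0.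
have theta0 : 0 < theta by rewrite divr_gt0// mulr_gt0.
have /andP[d0 d1] := d01.
near=> k.
have [M [be [Mk beJ beSol sep]]] : exists (M : nat) (be : nat -> R),
    [/\ kappa * (v - u) * k%:R <= M%:R,
        forall j, (j < M)%N -> u <= be j /\ be j + k%:R `^ (- v2) <= v,
        forall j al, (j < M)%N -> be j <= al <= be j + k%:R `^ (- v2) ->
          Sol k al &
        forall i j x y, (i < M)%N -> (j < M)%N -> i != j ->
          be i <= x <= be i + k%:R `^ (- v2) ->
          be j <= y <= be j + k%:R `^ (- v2) ->
          `|i%:R - j%:R| <= L * k%:R * `|x - y| ].
  by near: k; exact: br.
have k0 : (0 < k)%N by near: k; exists 1%N.
have k0' : 0 < k%:R :> R by rewrite ltr0n.
(* Here d v2 < 1 enters: about k children, each allowed a load of order k^(-d v2), outweigh the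
   fixed load of the parent. *)
have Ck : 2 * (v - u) `^ d / (kappa * (v - u)) <= k%:R `^ (1 - d * v2).
  by near: k; apply: near_le_powR; rewrite subr_gt0.
set sigma := k%:R `^ (- v2) in beJ beSol sep *.
have sigma0 : 0 < sigma by apply: powR_gt0.
have T0 : 0 < (theta * sigma) `^ d by rewrite powR_gt0// mulr_gt0.
have [|||||j jM jload] := @select_child M (L * k%:R) ((theta * sigma) `^ d)
  ((theta * (v - u)) `^ d) (theta * (v - u)) w (fun i => w i `^ d^-1)
  (hits U u v) (fun i j => hits U (be j) (be j + sigma) i) w0 (fun=> powR_ge0 _ _)
  T0 (mulr_ge0 (ltW L0) (ltW k0')).
- move=> i j jM /asboolP[x Ux /andP[x1 x2]]; apply/asboolP; exists x => //.
  have [p1 p2] := beJ j jM.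
  by rewrite (le_trans p1 x1) (le_trans x2 p2).
- move=> i j j' jM j'M jj' /asboolP[x Ux xj] /asboolP[y Uy yj].
  apply: le_trans (sep j j' x y jM j'M jj' xj yj) _.
  by rewrite ler_wpM2l ?(mulr_ge0 (ltW L0) (ltW k0'))//; exact: Uw Ux Uy.
- exact: load.
- move=> N; apply: sum_powR_inv => //; exact: ltW (mulr_gt0 theta0 rho0).
(* The choice of theta makes the cost of repeated meetings a quarter of the lower bound for M T; a
   large k makes the parent's load at most half of it. *)
- have -> : (theta * sigma) `^ d * (L * k%:R) * (theta * (v - u)) =
      (theta * sigma) `^ d * (kappa * (v - u) * k%:R) / 4.
    by rewrite /theta; field; rewrite gt_eqF.
  have X0 : 0 < kappa * (v - u) * k%:R by rewrite !mulr_gt0.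
  have S1 : (theta * (v - u)) `^ d <=
      (theta * sigma) `^ d * (kappa * (v - u) * k%:R) / 2.
    have sd : sigma `^ d * k%:R = k%:R `^ (1 - d * v2).
      have -> : 1 - d * v2 = - v2 * d + 1 by ring.
      by rewrite gt0_powRD// powRrM (powRr1 (ltW k0')).
    have th : 0 <= theta `^ d by apply: powR_ge0.
    rewrite (powRM _ (ltW theta0) (ltW rho0)) (powRM _ (ltW theta0) (ltW sigma0)).
    have -> : theta `^ d * sigma `^ d * (kappa * (v - u) * k%:R) / 2 =
       theta `^ d * (sigma `^ d * k%:R * (kappa * (v - u)) / 2) by ring.
    rewrite ler_wpM2l// sd ler_pdivlMr// mulrC -ler_pdivrMr// mulr_gt0//.
  have := ler_wpM2l (ltW T0) Mk; have := mulr_gt0 T0 X0.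
  move: S1; rewrite (mulrC M%:R).
  set A := _ `^ d; set T := _ `^ d; set X := kappa * _ * _.
  by clear; lra.
exists (be j); have [p1 p2] := beJ j jM; split => //.
by move=> al; exact: beSol.
Unshelve. all: end_near. Qed.

(** Iterating [avoid_step] gives shrinking nested intervals with a common point x. At some stage the
    allowed load falls below the fixed weight w i > 0; a member U i containing x would meet that
    interval and exceed the allowance alone. *)
Lemma avoid_cover Sol (u0 v0 v2 kappa L d : R) (U : (set R)^nat)
    (w : nat -> R) :
  let theta := kappa / (4 * L) in
  branching Sol u0 v0 v2 kappa L -> 0 < kappa -> 0 < L -> 0 < d <= 1 ->
  d * v2 < 1 -> 0 < v2 -> (forall i, 0 < w i) ->
  (forall i x y, U i x -> U i y -> `|x - y| <= w i `^ d^-1) -> u0 < v0 ->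
  (forall N, \sum_(i < N) w i <= (theta * (v0 - u0)) `^ d) ->
  exists2 x, u0 <= x <= v0 & (forall i, ~ U i x) /\
    forall K, exists2 k, (K <= k)%N & Sol k x.
Proof.
move=> theta br ka0 L0 d01 dv2 v20 w0 Uw uv0 load.
have theta0 : 0 < theta by rewrite divr_gt0// mulr_gt0.
have /andP[d0 d1] := d01.
pose P (p : R * R) := [/\ u0 <= p.1, p.1 < p.2, p.2 <= v0 &
  forall N, \sum_(i < N | hits U p.1 p.2 i) w i <= (theta * (p.2 - p.1)) `^ d].
(* The index paired with the interval forces step n to use some k >= n and to reach length at most 1
   / n. *)
have step (Kp : nat * (R * R)) : exists p, P Kp.2 -> [/\ P p,
    Kp.2.1 <= p.1, p.2 <= Kp.2.2, (p.2 - p.1) * Kp.1%:R <= 1 &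
    exists2 k, (Kp.1 <= k)%N & forall al, p.1 <= al <= p.2 -> Sol k al].
  case: Kp => K [u v] /=.
  have [[u0u uv vv0 ld]|nP] := pselect (P (u, v)); last by exists (u, v).
  have := @avoid_step _ _ _ _ _ _ _ _ _ _ _ br ka0 L0 d01 dv2
    (fun i => ltW (w0 i)) Uw u0u uv vv0 ld.
  rewrite -/theta => nr.
  have nK : \forall k \near \oo, (K <= k)%N by exists K.
  have nv : \forall k \near \oo, K%:R <= (k%:R : R) `^ v2 by exact: near_le_powR.
  have n1 : \forall k \near \oo, (0 < k)%N by exists 1%N.
  have [k [[u' [p1 p2 p3 p4]] Kk Kv k0]] : exists k, [/\ exists u',
    [/\ u <= u', u' + k%:R `^ (- v2) <= v,
        forall al, u' <= al <= u' + k%:R `^ (- v2) -> Sol k al &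
        forall N, \sum_(i < N | hits U u' (u' + k%:R `^ (- v2)) i) w i <=
          (theta * k%:R `^ (- v2)) `^ d], (K <= k)%N,
     K%:R <= (k%:R : R) `^ v2 & (0 < k)%N].
    near \oo => k; exists k; split; near: k; assumption.
  have s0 : 0 < (k%:R : R) `^ v2 by rewrite powR_gt0// ltr0n.
  have s0' : 0 < (k%:R : R) `^ (- v2) by rewrite powR_gt0// ltr0n.
  have se : u' + k%:R `^ (- v2) - u' = k%:R `^ (- v2) by rewrite addrAC subrr add0r.
  exists (u', u' + k%:R `^ (- v2)) => _; split => /=.
  - split => //=; first exact: le_trans p1.
    + by rewrite ltrDl.
    + exact: le_trans vv0.
    + by move=> N; rewrite se; exact: p4.
  - exact: p1.
  - exact: p2.
  - by rewrite se powRN mulrC ler_pdivrMr// mul1r.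
  - by exists k.
have [f fP] := choice step.
pose p := fix p n := if n is m.+1 then f (m, p m) else (u0, v0).
have pP n : P (p n).
  elim: n => [|n IH] /=; last by have [] := fP (n, p n) IH.
  split => //= N; apply: le_trans (load N).
  rewrite big_mkcond /=; apply: ler_sum => i _.
  by case: ifP => // _; exact: ltW.
have pS n : [/\ (p n).1 <= (p n.+1).1, (p n.+1).2 <= (p n).2,
    ((p n.+1).2 - (p n.+1).1) * n%:R <= 1 &
    exists2 k, (n <= k)%N & forall al, (p n.+1).1 <= al <= (p n.+1).2 -> Sol k al].
  by have [] := fP (n, p n) (pP n).
clearbody p.
have mono1 n m : (n <= m)%N -> (p n).1 <= (p m).1.
  elim: m => [|m IH]; first by rewrite leqn0 => /eqP ->.
  rewrite leq_eqVlt ltnS => /predU1P[->//|/IH h].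
  by apply: le_trans h _; have [] := pS m.
have mono2 n m : (n <= m)%N -> (p m).2 <= (p n).2.
  elim: m => [|m IH]; first by rewrite leqn0 => /eqP ->.
  rewrite leq_eqVlt ltnS => /predU1P[->//|/IH h].
  by apply: le_trans h; have [] := pS m.
have p12 n m : (p n).1 <= (p m).2.
  have [nm|/ltnW mn] := leqP n m.
    by apply: le_trans (mono1 _ _ nm) _; apply: ltW; have [] := pP m.
  by apply: le_trans (mono2 _ _ mn); apply: ltW; have [] := pP n.
pose x := sup (range (fun n => (p n).1)).
have xP n : (p n).1 <= x <= (p n).2.
  apply/andP; split.
    apply: ub_le_sup; last by exists n.
    by exists (p n).2 => _ [m _ <-].
  by apply: ge_sup; [exists (p 0%N).1, 0%N|move=> _ [m _ <-]].
exists x.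
  have [h1 _ h2 _] := pP 0%N; have /andP[h3 h4] := xP 0%N.
  by rewrite (le_trans h1 h3) (le_trans h4 h2).
split => [i Ux|K]; last first.
  have [_ _ _ [k Kk sol]] := pS K; exists k => //; exact: sol.
have wi0 : 0 < w i `^ d^-1 by apply: powR_gt0.
(* For this n, a length of at most 1 / n makes theta times the length smaller than w i^(1/d). *)
have [n nP] : exists n : nat, theta / w i `^ d^-1 < n%:R.
  by exists (Num.truncn (theta / w i `^ d^-1)).+1; rewrite truncnS_gt.
have [_ _ small _] := pS n; have [_ p1 _ ld] := pP n.+1.
have : theta * ((p n.+1).2 - (p n.+1).1) < w i `^ d^-1.
  have n0 : 0 < n%:R :> R by apply: le_lt_trans nP; rewrite divr_ge0// ltW.
  rewrite -(ltr_pM2r n0); move: nP; rewrite ltr_pdivrMr// mulrC => nP.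
  by apply: le_lt_trans nP; rewrite -mulrA -[leRHS]mulr1 ler_wpM2l// ltW.
have rho0 : 0 < theta * ((p n.+1).2 - (p n.+1).1).
  by rewrite mulr_gt0// subr_gt0.
move=> /(gt0_ltr_powR d0); rewrite !nnegrE => /(_ (ltW rho0) (ltW wi0)).
rewrite -powRrM mulVf ?gt_eqF// powRr1 ?(ltW (w0 i))//; apply/negP.
rewrite -leNgt; apply: le_trans (ld i.+1).
rewrite (bigD1 (ord_max : 'I_i.+1)) /=; last by apply/asboolP; exists x.
by rewrite lerDl; apply: sumr_ge0 => j _; exact: ltW.
Unshelve. all: end_near. Qed.

End Avoid.

(** * Hausdorff dimension *)

Section HausdorffBound.
Context {R : realType}.

(** In a finite list of solutions every |x| is at most their sum, whereas a solution above a larger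
    k has x >= k. *)
Lemma solvable_of_solution_above (a b c : nat) (al : R) :
  (forall K, exists2 k, (K <= k)%N & solution_above a b c k al) ->
  solvable_in_PS a b c al.
Proof.
move=> above /finite_seqP[s sE].
pose K := (\sum_(p <- s) `|p.1.1|).+1.
have [k Kk [x [y [z [xyz [u [e kx]]]]]]] := above K.
have ins : (x, y, z) \in s.
  by change ([set` s] (x, y, z)); rewrite -sE.
have : (`|x| <= \sum_(p <- s) `|p.1.1|)%N.
  by rewrite (big_rem _ ins)/= leq_addr.
rewrite -ltnS -/K leqNgt => /negP; apply.
move: kx Kk; clear; lia.
Qed.

(** With f the fractional part, the denominator is at most (2 + f) (2 - f) <= 4 <= s^2, so the
    fraction is at least s and the inverted sum at least 2 s. *)
Lemma exponent_le_inv (s : R) : 2 < s ->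
  0 <= (s + s ^+ 3 / ((2 + frac_part s - 2 ^ (1 - Num.floor s))
                     * (2 - frac_part s)))^-1 /\
  2 * (s + s ^+ 3 / ((2 + frac_part s - 2 ^ (1 - Num.floor s))
                     * (2 - frac_part s)))^-1 <= s^-1.
Proof.
move=> s2; set f := frac_part s; set e := 2 ^ _.
have /andP[f0 f1] : 0 <= f < 1.
  have /andP[] := floor_itv s; rewrite intrD /f /frac_part; lra.
have e0 : 0 < e by rewrite exprz_gt0.
have e1 : e <= 1.
  have fl : (2 <= Num.floor s)%R by rewrite floor_ge_int ltW.
  rewrite /e; have -> : 1 - Num.floor s = - (`|Num.floor s - 1|%N : int).
    by clear -fl; lia.
  rewrite -exprz_inv -exprnP exprn_ile1//; lra.
clearbody f e.
set g := (2 + f - e) * (2 - f).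
have g0 : 0 < g by rewrite mulr_gt0//; lra.
have g4 : g <= 4 by rewrite /g; nra.
have gs : s <= s ^+ 3 / g.
  rewrite ler_pdivlMr//; rewrite !exprS expr0 mulr1 ler_wpM2l//; [lra|nra].
have ss : s + s <= s + s ^+ 3 / g by lra.
have s0 : 0 < s by lra.
split; first by rewrite invr_ge0; lra.
have X0 : 0 < s + s ^+ 3 / g by lra.
rewrite ler_pdivrMr// [leRHS]mulrC ler_pdivlMr//; lra.
Qed.

Lemma cover_of_null (d eps : R) (A : set R) : 0 < eps ->
  hausdorff_measure d A = 0%E ->
  exists U : (set R)^nat, [/\ A `<=` \bigcup_k U k,
    forall k, (diam (U k) <= 1)%E &
    (\sum_(0 <= k <oo) gauge d (U k) < eps%:E)%E].
Proof.
move=> eps0 H0.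
have : (hausdorff_premeasure d 1 A <= 0)%E.
  by rewrite -H0; apply: ereal_sup_ubound; exists 1 => //=.
move=> pre; have : (hausdorff_premeasure d 1 A < eps%:E)%E.
  by apply: le_lt_trans pre _; rewrite lte_fin.
by move=> /ereal_inf_lt[_ [U [AU dU] <-] lt]; exists U.
Qed.

Lemma diam_ge (U : set R) x y : U x -> U y -> (`|x - y|%:E <= diam U)%E.
Proof.
move=> Ux Uy; rewrite /diam le_max; apply/orP; right.
by apply: ereal_sup_ubound; exists (x, y).
Qed.

Lemma gauge_ge0 d (U : set R) : (0 <= gauge d U)%E.
Proof. by rewrite /gauge; case: ifP => // _; exact: poweR_ge0. Qed.

(** Passing to d' > d, possible since the diameter is at most 1, gives a positive exponent even when
    d = 0, so that 1/d' makes sense. *)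
Lemma dist_le_gauge (d d' : R) (U : set R) x y : 0 <= d -> d < d' ->
  (diam U <= 1)%E -> U x -> U y -> ((`|x - y| `^ d')%:E <= gauge d U)%E.
Proof.
move=> d0 dd' dU Ux Uy; rewrite /gauge ifF; last first.
  by apply/negbTE/set0P; exists x.
have xyd := diam_ge _ _ _ Ux Uy.
have dfin : diam U \is a fin_num.
  rewrite fin_numElt (lt_le_trans _ xyd) ?ltNyr//=.
  by apply: le_lt_trans dU _; rewrite ltry.
move: xyd dU; rewrite -(fineK dfin) poweR_EFin !lee_fin.
move: (fine _) => D xyD D1.
have [->|xy0] := eqVneq `|x - y| 0.
  by rewrite powR0 ?powR_ge0// gt_eqF// (le_lt_trans d0).
have xy0' : 0 < `|x - y| by rewrite lt_def xy0 normr_ge0.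
apply: (@le_trans _ _ (`|x - y| `^ d)).
  by apply: ger_powR; [rewrite xy0' (le_trans xyD)|exact: ltW].
by apply: ge0_ler_powR; rewrite ?nnegrE// (le_trans _ xyD).
Qed.

Lemma geometric_sum (eps : R) N :
  \sum_(i < N) eps / 2 ^+ i.+1 = eps * (1 - 2 ^- N).
Proof.
elim: N => [|N IH]; first by rewrite big_ord0 expr0 invr1 subrr mulr0.
by rewrite big_ord_recr /= IH exprS; field; rewrite expf_neq0.
Qed.

(* The extra weights eps / 2 ^ i make room for singletons, whose gauge is 0. *)
Lemma weighted_cover (d d' eps : R) (A : set R) : 0 <= d -> d < d' -> 0 < eps ->
  hausdorff_measure d A = 0%E ->
  exists (U : (set R)^nat) (w : nat -> R), [/\ A `<=` \bigcup_k U k,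
    forall i, 0 < w i,
    forall i x y, U i x -> U i y -> `|x - y| <= w i `^ d'^-1 &
    forall N, \sum_(i < N) w i <= eps].
Proof.
move=> d0 dd' eps0 H0; have e20 : 0 < eps / 2 by rewrite divr_gt0.
have [U [AU dU sU]] := cover_of_null _ _ _ e20 H0.
have part N : (\sum_(i < N) gauge d (U i) < (eps / 2)%:E)%E.
  apply: le_lt_trans sU.
  rewrite -(big_mkord xpredT (fun i => gauge d (U i))).
  by apply: nneseries_lim_ge => i _ _; exact: gauge_ge0.
have gfin i : gauge d (U i) \is a fin_num.
  rewrite fin_numElt (lt_le_trans _ (gauge_ge0 _ _)) ?ltNyr//=.
  apply: le_lt_trans (lt_trans (part i.+1) (ltry _)).
  rewrite big_ord_recr /= leeDr//; apply: sume_ge0 => j _; exact: gauge_ge0.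
pose w i := fine (gauge d (U i)) + (eps / 2) / 2 ^+ i.+1.
have g0 i : 0 <= fine (gauge d (U i)) by rewrite fine_ge0// gauge_ge0.
have w2 i : 0 < (eps / 2) / 2 ^+ i.+1 :> R by rewrite divr_gt0// exprn_gt0.
exists U, w; split => //.
- by move=> i; rewrite ltr_wpDl.
- move=> i x y Ux Uy; have d'0 : 0 < d' by exact: le_lt_trans dd'.
  have d'1 : d' * d'^-1 = 1 by rewrite mulfV// gt_eqF.
  rewrite -[leLHS](powRr1 (normr_ge0 _)) -[X in _ `^ X]d'1 powRrM.
  apply: ge0_ler_powR; rewrite ?nnegrE ?powR_ge0 ?invr_ge0 ?(ltW d'0)//.
    by rewrite /w addr_ge0// ltW.
  apply: (@le_trans _ _ (fine (gauge d (U i)))); last by rewrite /w lerDl ltW.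
  by rewrite -lee_fin fineK//; apply: dist_le_gauge.
- move=> N; rewrite big_split /= geometric_sum.
  have : \sum_(i < N) fine (gauge d (U i)) <= eps / 2.
    rewrite -lee_fin -sumEFin (eq_bigr (fun i : 'I_N => gauge d (U i))); first exact/ltW/part.
    by move=> i _; rewrite fineK.
  have : 0 <= eps / 2 * 2 ^- N by rewrite mulr_ge0 ?invr_ge0 ?exprn_ge0// ltW.
  by lra.
Qed.

(** A single Q above four thresholds in a, b, c and w0 serves every subinterval, which makes [kappa]
    and [L] uniform. *)
Lemma level_branching (a b c : nat) (s w0 v2 : R) :
  (0 < a)%N -> (0 < b)%N -> (0 < c)%N -> 2 <= s -> s < w0 -> w0 < v2 ->
  exists kappa L : R, [/\ 0 < kappa, 0 < L &
    branching (solution_above a b c) s w0 v2 kappa L].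
Proof.
move=> a0 b0 c0 s2 sw wv.
have c1 : 1 <= c%:R :> R by rewrite ler1n.
pose eta : R := (4 * (a%:R + b%:R + 1))^-1.
have eta0 : 0 < eta by rewrite invr_gt0 mulr_gt0// !addr_gt0// ltr0n.
have w00 : 0 < w0 by apply: le_lt_trans sw; exact: le_trans s2.
pose q1 : R := a%:R + c%:R + 3; pose q2 : R := 2 * a%:R.
pose q3 : R := c%:R / eta; pose q4 : R := 2 * c%:R * w0 * (a%:R + 1).
have q10 : 0 <= q1 by rewrite /q1 !addr_ge0.
have q20 : 0 <= q2 by rewrite /q2 mulr_ge0.
have q30 : 0 <= q3 by rewrite /q3 divr_ge0// ltW.
have q40 : 0 <= q4 by rewrite /q4 !mulr_ge0 ?addr_ge0// ltW.
pose Q := (Num.truncn (q1 + q2 + q3 + q4)).+1.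
have QP : q1 + q2 + q3 + q4 <= Q%:R by apply/ltW; exact: truncnS_gt.
clearbody Q.
have Q1 : q1 <= Q%:R by clear -QP q10 q20 q30 q40; lra.
have Q2 : q2 <= Q%:R by clear -QP q10 q20 q30 q40; lra.
have Q3 : q3 <= Q%:R by clear -QP q10 q20 q30 q40; lra.
have Q4 : q4 <= Q%:R by clear -QP q10 q20 q30 q40; lra.
have Qeta : c%:R <= Q%:R * eta by rewrite -ler_pdivrMr.
have B0 : 0 < (a%:R + b%:R) * Q%:R :> R.
  rewrite mulr_gt0 ?addr_gt0 ?ltr0n// -(ltr0n R); apply: lt_le_trans Q1.
  by rewrite ltr_wpDl// addr_ge0.
have B1 : 1 <= (a%:R + b%:R) * Q%:R :> R.
  by rewrite -natrD -natrM ler1n -(ltr0n R) natrM natrD.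
exists (1 / (8 * c%:R * w0 * ((a%:R + b%:R) * Q%:R) `^ w0)).
exists (2 * curve_lip a%:R b%:R Q%:R w0 + 1); split.
- by rewrite divr_gt0// !mulr_gt0 ?powR_gt0// ltr0n.
- rewrite ltr_wpDl// mulr_ge0//.
  by rewrite /curve_lip !mulr_ge0 ?powR_ge0 ?ln_ge0// addr_ge0.
move=> u v su uv vw; have u2 : 2 <= u by exact: le_trans su.
have lev := @level _ a b c Q u v w0 v2 a0 b0 c0 Q1 Q2 Qeta Q4 u2 uv vw wv.
apply: filterS lev => k [M [be [Mk h1 h2 h3]]].
exists M, be; split => //.
- by apply: le_trans Mk; rewrite mul1r (mulrC _^-1).
- move=> i j x y iM jM ij xi yj; apply: le_trans (h3 i j x y iM jM ij xi yj) _.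
  by rewrite ler_wpM2r// ler_wpM2r// lerDl.
Qed.

(** Since d < 1/s, there is room for d < d' < 1/s and s < w0 < v2 < 1/d', so that d' v2 < 1. On
    [s, w0] the windows have length k^(-v2), and a null set would have a cover light enough for
    [avoid_cover]. *)
Lemma hausdorff_measure_solvable_neq0 (a b c : nat) (s t d : R) :
  (0 < a)%N -> (0 < b)%N -> (0 < c)%N -> 2 <= s -> s < t -> 0 <= d -> d < s^-1 ->
  hausdorff_measure d
    [set alpha : R | (s <= alpha <= t)%R /\ solvable_in_PS a b c alpha] <> 0%E.
Proof.
move=> a0 b0 c0 s2 st d0 ds H0.
have s0 : 0 < s by exact: lt_le_trans s2.
pose d' := (d + s^-1) / 2.
have dd' : d < d' by rewrite /d'; clear -ds; lra.
have d's : d' < s^-1 by rewrite /d'; clear -ds; lra.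
have d'0 : 0 < d' by exact: le_lt_trans dd'.
have sd' : s < d'^-1 by rewrite -[ltLHS]invrK ltf_pV2 ?posrE ?invr_gt0.
have d'1 : d' <= 1.
  apply: le_trans (ltW d's) _; rewrite invf_le1//; apply: le_trans s2.
  by rewrite ler1n.
pose w0 := Num.min t ((s + d'^-1) / 2).
have sw : s < w0 by rewrite /w0 lt_min st; clear -sd'; lra.
have wt : w0 <= t by rewrite /w0 ge_min lexx.
have wd' : w0 < d'^-1.
  by rewrite /w0 gt_min; apply/orP; right; clear -sd'; lra.
pose v2 := (w0 + d'^-1) / 2.
have wv : w0 < v2 by rewrite /v2; clear -wd'; lra.
have vd' : d' * v2 < 1.
  rewrite -(mulfV (x := d')) ?gt_eqF// ltr_pM2l//.
  by rewrite /v2; clear -wd'; lra.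
have v20 : 0 < v2 by exact: lt_trans s0 (lt_trans sw wv).
have [kappa [L [ka0 L0 br]]] := level_branching _ _ _ _ _ _ a0 b0 c0 s2 sw wv.
have eps0 : 0 < (kappa / (4 * L) * (w0 - s)) `^ d'.
  by rewrite powR_gt0// mulr_gt0 ?subr_gt0// divr_gt0// mulr_gt0.
have [U [w [AU w_gt0 Uw wS]]] := weighted_cover _ _ _ _ d0 dd' eps0 H0.
have d'01 : 0 < d' <= 1 by rewrite d'0.
have [x /andP[sx xw] [xU xsol]] :=
  @avoid_cover _ _ _ _ _ _ _ _ _ _ br ka0 L0 d'01 vd' v20 w_gt0 Uw sw wS.
have [] : (\bigcup_k U k) x; last by move=> i _; exact: xU.
apply: AU; split; last exact: solvable_of_solution_above.
by rewrite sx (le_trans xw).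
Qed.

End HausdorffBound.

Theorem theorem1p1 (R : realType) (a b c : nat) (s t : R)
    (ha : (0 < a)%N) (hb : (0 < b)%N) (hc : (0 < c)%N)
    (hs : 2 < s) (hst : s < t) :
  ((if (a == b) && (b == c) then
      (s + s ^+ 3 / ((2 + frac_part s - 2 ^ (1 - Num.floor s))
                     * (2 - frac_part s)))^-1
    else
      2 * (s + s ^+ 3 / ((2 + frac_part s - 2 ^ (1 - Num.floor s))
                         * (2 - frac_part s)))^-1)%:E
   <= hausdorff_dim
        [set alpha : R | (s <= alpha <= t)%R /\ solvable_in_PS a b c alpha])%E.
Proof.
(* Both cases are at most 1/s; it remains to see that measure zero forces d >= 1/s. *)
apply: (@le_trans _ _ (s^-1)%:E).
  have [p q] := exponent_le_inv s hs; rewrite lee_fin; case: ifP => // _; lra.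
apply: le_ereal_inf_tmp => _ [d [d0 H0] <-]; rewrite lee_fin leNgt.
apply/negP => ds.
exact: (hausdorff_measure_solvable_neq0 _ _ _ _ _ _ ha hb hc (ltW hs) hst d0 ds H0).
Qed.
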